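(* Let $(p_m)_{m\geq 1}$ be a sequence in $[0,1)$ with $p_m=\omega(1/m)$, i.e. $m\,p_m\to\infty$ as $m\to\infty$, and write $p=p_m$. Then $p\,(1-p)^m\,(T_{m,p}-m\log m)$ converges in law, as $m\to\infty$, to an exponential distribution with rate $1$.
   Context: For an integer $m\geq 1$, let $\{C_n\}_{n\geq 1}$ be uniformly distributed on $[m]=\{1,\dots,m\}$ and $\{U_n\}_{n\geq1}$ be uniformly distributed on $(0,1)$, with the whole family $\{U_n,C_n\}_{n\geq1}$ independent. For $i\in[m]$ and $n>0$ let $L(i,n)=\sup\{1\leq k\leq n : C_k=i\}$ (with $\sup\emptyset=-\infty$). For $p\in[0,1)$ the clumsy coupon collection time is $$T_{m,p}=\inf\{n>0 : L(i,n)>0 \text{ and } U_{L(i,n)}\leq 1-p \text{ for all } i\in[m]\}.$$ *)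

(* Defs.v *)
(* MathComp-Analysis. [measurable_realfun] is not exported by [all_analysis]
   but provides the measurable structure of [\bar R]. *)
From HB Require Import structures.
From mathcomp Require Import all_boot all_order all_algebra finmap.
From mathcomp Require Import all_classical all_reals all_analysis measurable_realfun.
Set Implicit Arguments.
Unset Strict Implicit.
Unset Printing Implicit Defensive.
Import Order.TTheory GRing.Theory Num.Theory.
Import numFieldNormedType.Exports.

Local Open Scope classical_set_scope.
Local Open Scope ring_scope.

Definition mutually_independent {d} {T : measurableType d} {R : realType}
    (P : probability T R) (I : choiceType) (D : set I)
    (F : I -> set_system T) : Prop :=
  forall (J : {fset I}) (E : I -> set T),
    [set` J] `<=` D -> (forall i, i \in J -> F i (E i)) ->
    P (\bigcap_(i in [set` J]) E i) = (\prod_(i <- J) P (E i))%E.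

Definition sigma_rv {d d'} {T : measurableType d} {T' : measurableType d'}
    (X : T -> T') : set_system T :=
  preimage_set_system [set: T] X measurable.

Section clumsy_coupon_collector.
Context {d} {T : measurableType d} {R : realType}.

Section model.
Variables (P : probability T R) (m : nat).
(* [C n] and [U n] are only constrained for n >= 1; coupons are 1, ..., m.
   [uniform_prob (@ltr01 R)] has density 1 on [0, 1], hence is also the uniform
   law on the open interval. *)
Variables (C : nat -> {RV P >-> nat}) (U : nat -> {RV P >-> R}).

Definition coupon_model : Prop :=
  [/\ forall n i : nat, (0 < n)%N -> (1 <= i <= m)%N ->
        distribution P (C n) [set i] = (m%:R^-1)%:E,
      forall n : nat, (0 < n)%N ->
        forall A, measurable A ->
        distribution P (U n) A = uniform_prob (@ltr01 R) A
    & mutually_independent P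
        [set j : nat + nat | match j with inl n | inr n => (0 < n)%N end]
        (fun j => match j with
                  | inl n => sigma_rv (U n)
                  | inr n => sigma_rv (C n)
                  end)].

End model.

Variables (m : nat) (p : R) (C : nat -> T -> nat) (U : nat -> T -> R).

(* L(i, n); the value 0 stands for sup set0 = -oo, so that [0 < last_seen]
   holds exactly when coupon i has been drawn by time n. *)
Definition last_seen (i n : nat) (w : T) : nat :=
  (\max_(1 <= k < n.+1 | C k w == i) k)%N.

Definition complete_at (n : nat) (w : T) : Prop :=
  forall i : nat, (1 <= i <= m)%N ->
    (0 < last_seen i n w)%N /\ U (last_seen i n w) w <= 1 - p.

(* T_{m,p}; it is +oo where the collection is never complete. *)
Definition clumsy_time (w : T) : \bar R :=
  ereal_inf [set n%:R%:E | n in [set n : nat | (0 < n)%N /\ complete_at n w]].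

End clumsy_coupon_collector.

(* Convergence in law of extended-real random variables, each on its own
   probability space, to a law on the real line: pointwise convergence of the
   distribution functions at the continuity points of the limit. As [mu] has
   mass 1 on R, no mass is lost at +oo or -oo in the limit. *)
Definition cvg_in_law {R : realType} {d : nat -> measure_display}
    {T : forall m, measurableType (d m)} (P : forall m, probability (T m) R)
    (X : forall m, T m -> \bar R) (mu : probability (measurableTypeR R) R)
    : Prop :=
  (forall m, measurable_fun [set: T m] (X m)) /\
  forall x : R, {for x, continuous (fun t : R => mu `]-oo, t]%classic)} ->
    P m [set w | (X m w <= x%:E)%E] @[m --> \oo] --> mu `]-oo, x]%classic.

(* The library's probability structure on [exponential_prob r] depends on a
   proof of [0 < r], which inference cannot supply. *)
Definition exponential_law {R : realType} (r : R) (r_gt0 : 0 < r)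
    : probability (measurableTypeR R) R :=
  @exponential_distribution_exponential_prob__canonical__probability_measure_Probability R r r_gt0.

(* Main.v *)
(* The set of coupons whose last copy is good is a Markov chain on subsets of [m],
   started at the empty set; T is the hitting time of the full set. The products
   over i in B of (1_{i in S} - (1 - p)) are eigenfunctions of the chain, with
   eigenvalue 1 - #|B| / m. Expanding the indicator of the full set along them
   gives P_S(X_n = full) exactly: from the full set it is E (1 - K/m)^n with K
   binomial (m, p), and from the empty set it is (1 - p)^m q_n, where q_n is the
   probability that m coupons are all seen after n classical draws.
   Write F_N = P(T <= N) and delta = p (1 - p)^m. Decomposing at the first visit
   to the full set yields
     Y_N := delta * sum_{n < N} (q_n - F_n)
          = p * sum_{k < N} P(T = k) * sum_{j < N - k} (P_full(X_j = full) - (1 - p)^m).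
   The inner sum converges geometrically, with rate 1 - 1/m, to alpha / p where
   alpha = E [m p / K; K > 0], and alpha tends to 1 as m p tends to infinity. Thus
   Y_N is close to F_N, and as Y_N is negligible up to m log m and q_n close to 1
   slightly later, the recurrence Y_{N+1} - Y_N = delta (q_N - F_N) is, past
   m log m, an Euler scheme of step delta for y' = 1 - y, whence
   F_N ~ 1 - e^{-delta (N - m log m)}. *)
Require Import Defs.
From HB Require Import structures.
From mathcomp Require Import all_boot all_order all_algebra.
From mathcomp Require Import all_classical all_reals all_analysis measurable_realfun.
From mathcomp Require Import ring lra finmap.
Set Implicit Arguments.
Unset Strict Implicit.
Unset Printing Implicit Defensive.
Import Order.TTheory GRing.Theory Num.Theory.
Import numFieldNormedType.Exports.

Local Open Scope classical_set_scope.
Local Open Scope ring_scope.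

(** * Spectral decomposition of the chain of good coupon sets *)

Section chain.
Variables (R : realFieldType) (m : nat) (p : R).
Implicit Types (S B : {set 'I_m}) (f : {set 'I_m} -> R).

(** One-step expectation operator of the chain: a uniform coupon [i] enters [S] with probability
    [1 - p] (a good copy) and leaves it with probability [p]. *)
Definition transition f S : R :=
  m%:R^-1 * \sum_(i < m) ((1 - p) * f (i |: S)%SET + p * f (S :\ i)%SET).

Definition full S : bool := S == [set: 'I_m]%SET.

(* The eigenfunctions of [transition]: the indicators centred at their
   stationary mean [1 - p]. *)
Definition walsh B S : R := \prod_(i in B) ((i \in S)%:R - (1 - p)).

Lemma card_notin B : #|[pred i | i \notin B]| = (m - #|B|)%N.
Proof.
apply: (@addnI #|B|); rewrite subnKC; last by rewrite -[leqRHS]card_ord max_card.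
by have := cardC (mem B); rewrite card_ord.
Qed.

(** If the drawn coupon lies in [B], its factor becomes [p] with probability [1 - p] and [-(1 - p)]
    with probability [p], so these draws average to zero. The other [m - #|B|] draws leave the
    product unchanged. *)
Lemma walsh_transition B S : (0 < m)%N ->
  transition (walsh B) S = (1 - #|B|%:R / m%:R) * walsh B S.
Proof.
move=> m_gt0.
have m0 : m%:R != 0 :> R by rewrite pnatr_eq0 -lt0n.
rewrite /transition.
have -> : \sum_(i < m) ((1 - p) * walsh B (i |: S)%SET + p * walsh B (S :\ i)%SET)
    = \sum_(i < m | i \notin B) walsh B S.
  rewrite (bigID (mem B)) /= [X in X + _]big1 ?add0r => [|i iB]; last first.
    rewrite /walsh (bigD1 i iB) /= [in X in _ + _ * X](bigD1 i iB) /=.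
    rewrite !inE eqxx /=.
    have E : \prod_(j in B | j != i) ((j \in (i |: S)%SET)%:R - (1 - p)) =
             \prod_(j in B | j != i) ((j \in (S :\ i)%SET)%:R - (1 - p)).
      by apply: eq_bigr => j /andP[_ ji]; rewrite !inE (negbTE ji).
    by rewrite E; ring.
  apply: eq_bigr => i iB.
  have -> : walsh B (i |: S)%SET = walsh B S.
    apply: eq_bigr => j jB; rewrite !inE; case: eqP => // ji.
    by rewrite -ji jB in iB.
  have -> : walsh B (S :\ i)%SET = walsh B S.
    apply: eq_bigr => j jB; rewrite !inE; case: eqP => // ji.
    by rewrite -ji jB in iB.
  by ring.
rewrite sumr_const card_notin -[_ *+ (m - _)]mulr_natl natrB; last
  by rewrite -[leqRHS]card_ord max_card.
by field.
Qed.

Lemma transition_sum (I : finType) (Q : pred I) (c : I -> R)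
    (g : I -> {set 'I_m} -> R) S :
  transition (fun S => \sum_(j | Q j) c j * g j S) S =
  \sum_(j | Q j) c j * transition (g j) S.
Proof.
rewrite /transition.
under eq_bigr do rewrite !mulr_sumr -big_split /=.
rewrite exchange_big /= mulr_sumr; apply: eq_bigr => j _.
rewrite mulrCA; congr (_ * _); rewrite mulr_sumr.
by apply: eq_bigr => i _; ring.
Qed.

Lemma eq_transition f g S : f =1 g -> transition f S = transition g S.
Proof. by move=> fg; rewrite /transition; under eq_bigr do rewrite !fg. Qed.

Lemma transition_cst c S : (0 < m)%N -> transition (fun=> c) S = c.
Proof.
move=> m_gt0; rewrite /transition sumr_const card_ord -mulr_natl.
have m0 : m%:R != 0 :> R by rewrite pnatr_eq0 -lt0n.
by field.
Qed.

(** The probability [P_S(X_n = full)]. *)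
Definition full_at n S : R := iter n transition (fun S => (full S)%:R) S.

(** The indicator is a product over all coupons. Each factor splits into its centred part plus
    [1 - p], and [B] collects the coupons contributing the centred part. *)
Lemma full_expansion S :
  (full S)%:R = \sum_(B : {set 'I_m}) (1 - p) ^+ (m - #|B|) * walsh B S.
Proof.
have -> : (full S)%:R = \prod_(i < m) (((i \in S)%:R - (1 - p)) + (1 - p)).
  have [/eqP ->|nS] := boolP (full S).
    by rewrite big1 // => i _; rewrite inE addrNK.
  have [i iS] : exists i, i \notin S.
    apply/existsP; rewrite -negb_forall; apply: contra nS => /forallP h.
    by apply/eqP/setP => i; rewrite inE h.
  by rewrite (bigD1 i) //= (negbTE iS) addrNK mul0r.
rewrite bigA_distr /=; apply: eq_bigr => B _.
rewrite (bigID (mem B)) /= mulrC; congr (_ * _).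
  rewrite (eq_bigr (fun=> 1 - p)) => [|i /negbTE -> //].
  by rewrite prodr_const card_notin.
by rewrite /walsh; apply: eq_bigr => i ->.
Qed.

Lemma full_atE n S : (0 < m)%N ->
  full_at n S =
  \sum_(B : {set 'I_m}) ((1 - p) ^+ (m - #|B|) * (1 - #|B|%:R / m%:R) ^+ n) * walsh B S.
Proof.
move=> m_gt0; elim: n S => [|n IH] S.
  by rewrite /full_at /= full_expansion; apply: eq_bigr => B _; rewrite expr0 mulr1.
rewrite /full_at /= -/(full_at n) (eq_transition _ IH) transition_sum.
by apply: eq_bigr => B _; rewrite walsh_transition // exprSr; ring.
Qed.

End chain.

(** * First passage to the full set *)

Section hitting.
Variables (R : realFieldType) (m : nat) (p : R).
Implicit Types (S B : {set 'I_m}) (f : {set 'I_m} -> R).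

Lemma le_transition f g S : 0 <= p <= 1 -> (forall S, f S <= g S) ->
  transition p f S <= transition p g S.
Proof.
move=> /andP[p0 p1] fg; rewrite ler_wpM2l ?invr_ge0 ?ler0n //.
by apply: ler_sum => i _; rewrite lerD // ler_wpM2l ?subr_ge0.
Qed.

Lemma le_iter_transition n f g S : 0 <= p <= 1 -> (forall S, f S <= g S) ->
  iter n (transition p) f S <= iter n (transition p) g S.
Proof.
by move=> p01 fg; elim: n S => //= n IH S; exact: le_transition.
Qed.

Lemma full_at_le1 n S : (0 < m)%N -> 0 <= p <= 1 -> full_at p n S <= 1.
Proof.
move=> m_gt0 p01; elim: n S => [|n IH] S; first by rewrite /full_at /= lern1 leq_b1.
by rewrite -(transition_cst p 1 S m_gt0); exact: le_transition.
Qed.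

(** At the full set every factor of [walsh] equals [p], so the sum is [E (1 - K/m)^n] with [K]
    binomial. *)
Lemma full_at_setT n : (0 < m)%N ->
  full_at p n [set: 'I_m]%SET =
  \sum_(B : {set 'I_m}) (1 - p) ^+ (m - #|B|) * p ^+ #|B|
                        * (1 - #|B|%:R / m%:R) ^+ n.
Proof.
move=> m_gt0; rewrite full_atE //; apply: eq_bigr => B _.
rewrite /walsh (eq_bigr (fun=> p)) => [|i _]; last by rewrite inE opprB addrC addrNK.
by rewrite prodr_const; ring.
Qed.

(** At the empty set every factor of [walsh] equals [-(1 - p)], so [p] enters each term only through
    [(1 - p)^m]. What remains is the chain with [p = 0], the classical collector. *)
Lemma full_at_set0 n : (0 < m)%N ->
  full_at p n (finset.set0 : {set 'I_m}) =
  (1 - p) ^+ m * full_at 0 n (finset.set0 : {set 'I_m}).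
Proof.
move=> m_gt0; rewrite !full_atE // mulr_sumr; apply: eq_bigr => B _.
have w (c : R) : walsh c B finset.set0 = (- 1) ^+ #|B| * (1 - c) ^+ #|B|.
  rewrite /walsh (eq_bigr (fun=> - 1 * (1 - c))) => [|i _].
    by rewrite prodr_const exprMn.
  by rewrite inE sub0r mulN1r.
rewrite !w subr0 !expr1n.
have -> : (1 - p) ^+ m = (1 - p) ^+ (m - #|B|) * (1 - p) ^+ #|B|.
  by rewrite -exprD subnK // -[leqRHS]card_ord max_card.
by ring.
Qed.

(** Probability that the chain started from [S] first visits the full set at time [k]; a full start
    counts at time 0 only. *)
Fixpoint first_at k S : R :=
  if k is k'.+1 then (if full S then 0 else transition p (first_at k') S)
  else (full S)%:R.

(** Distribution function of the hitting time of the full set from [S]; at the empty set it is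
    [F_N]. *)
Definition hit N S : R := \sum_(k < N.+1) first_at k S.

Lemma first_at_ge0 k S : (0 < m)%N -> 0 <= p <= 1 -> 0 <= first_at k S.
Proof.
move=> m_gt0 p01; elim: k S => [|k IH] S /=; first exact: ler0n.
by case: ifP => // _; rewrite -(transition_cst p 0 S m_gt0); exact: le_transition.
Qed.

Lemma hit0 S : hit 0 S = (full S)%:R.
Proof. by rewrite /hit big_ord1. Qed.

Lemma hitS N S : hit N.+1 S = if full S then 1 else transition p (hit N) S.
Proof.
rewrite /hit big_ord_recl /=; case: ifP => fS.
  by rewrite big1 ?addr0 // => k _; rewrite fS.
rewrite add0r.
have hE S' : \sum_(k < N.+1) first_at k S' = \sum_(k < N.+1) 1 * first_at k S'.
  by apply: eq_bigr => k _; rewrite mul1r.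
rewrite (eq_transition p S hE) transition_sum.
by apply: eq_bigr => k _; rewrite mul1r.
Qed.

Lemma hit_full N S : full S -> hit N S = 1.
Proof. by case: N => [|N] fS; rewrite ?hit0 ?hitS fS. Qed.

Lemma hit_ge0 N S : (0 < m)%N -> 0 <= p <= 1 -> 0 <= hit N S.
Proof. by move=> m_gt0 p01; apply: sumr_ge0 => k _; exact: first_at_ge0. Qed.

(** Markov property at the first visit to the full set, obtained by first-step analysis. *)
Lemma first_passage n S : 
  full_at p n S = \sum_(k < n.+1) first_at k S * full_at p (n - k) [set: 'I_m]%SET.
Proof.
have [fS|nfS] := boolP (full S).
  rewrite big_ord_recl /= fS mul1r subn0 big1 ?addr0.
    by rewrite (eqP fS).
  by move=> k _; rewrite mul0r.
elim: n S nfS => [|n IH] S nfS; first by rewrite big_ord1 /= (negbTE nfS) mul0r.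
(* The induction hypothesis covers non-full sets only, while one step may reach the full set; there
   only the term [k = 0] survives. *)
have IH' S' : full_at p n S' =
    \sum_(k < n.+1) full_at p (n - k) [set: 'I_m]%SET * first_at k S'.
  have [fS|/IH ->] := boolP (full S'); last by apply: eq_bigr => k _; rewrite mulrC.
  rewrite big_ord_recl /= fS mulr1 subn0 big1 ?addr0.
    by rewrite (eqP fS).
  by move=> k _; rewrite mulr0.
rewrite big_ord_recl /= (negbTE nfS) mul0r add0r.
rewrite /full_at /= -/(full_at p n) (eq_transition _ _ IH') transition_sum.
by apply: eq_bigr => k _; rewrite mulrC subSS.
Qed.

End hitting.

(** * The classical coupon collector *)

Section coupon_collector.
Variables (R : realFieldType) (m : nat).
Hypothesis m_gt1 : (1 < m)%N.
Implicit Types (S : {set 'I_m}) (g : R -> R).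

Let m_gt0 : (0 < m)%N := ltnW m_gt1.
Let m0 : m%:R != 0 :> R. Proof. by rewrite pnatr_eq0 -lt0n. Qed.
Let m2 : 2 <= m%:R :> R. Proof. by rewrite ler_nat. Qed.
Let r : R := 1 - m%:R^-1.

Definition missing S : R := #|~: S|%SET%:R.

(** With [p = 0] a draw hits a missing coupon with probability [missing S / m] and then lowers the
    count by one. *)
Lemma transition_missing g S : transition 0 (g \o missing) S =
  (1 - missing S / m%:R) * g (missing S) +
  missing S / m%:R * g (missing S - 1).
Proof.
rewrite /transition subr0 (bigID (mem S)) /=.
under eq_bigr => i iS.
  rewrite mul1r mul0r addr0 finset.setUC (finset.setUidPl _) ?finset.sub1set //; over.
under [X in _ + X]eq_bigr => i iS.
  rewrite mul1r mul0r addr0.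
  have -> : missing (i |: S)%SET = missing S - 1.
    rewrite /missing (cardsD1 i (~: S)%SET) inE iS natrD addrAC subrr add0r.
    congr (_%:R); apply: eq_card => j; rewrite !inE negb_or //.
  over.
rewrite !sumr_const.
have eZ : #|(fun i : 'I_m => i \notin S)|%:R = missing S.
  by congr (_%:R); apply: eq_card => i; rewrite !inE.
have eS : #|(fun i : 'I_m => i \in S)|%:R = m%:R - missing S.
  have := cardsC S; rewrite card_ord => /(congr1 (fun n : nat => n%:R : R)).
  rewrite natrD /missing => <-; rewrite addrK.
  by congr (_%:R); apply: eq_card => i; rewrite !inE.
rewrite -[_ *+ #|_|]mulr_natl -[X in _ + X]mulr_natl eZ eS.
by rewrite /=; field.
Qed.

(** The factorial powers [z] and [z (z - 1)] of the number of missing coupons are eigenfunctions,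
    with eigenvalues [1 - 1/m] and [1 - 2/m]. *)
Lemma iter_transition_missing n (a b c : R) S :
  iter n (transition 0)
    (fun S => a + b * missing S + c * (missing S * (missing S - 1))) S =
  a + b * (r ^+ n * missing S) +
  c * ((1 - 2 / m%:R) ^+ n * (missing S * (missing S - 1))).
Proof.
elim: n S => [|n IH] S; first by rewrite !expr0 !mul1r.
rewrite /= (eq_transition _ _ IH).
rewrite (transition_missing (fun z => a + b * (r ^+ n * z) +
   c * ((1 - 2 / m%:R) ^+ n * (z * (z - 1))))) !exprSr /r.
by field.
Qed.

(** The [q_n] of the overview. *)
Definition all_seen n : R := full_at 0 n (finset.set0 : {set 'I_m}).

Let in01 : 0 <= (0 : R) <= 1. Proof. by rewrite lexx ler01. Qed.

Lemma all_seen_le1 n : all_seen n <= 1. Proof. exact: full_at_le1. Qed.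

Let missing0 : missing finset.set0 = m%:R.
Proof. by rewrite /missing finset.setC0 cardsT card_ord. Qed.

Let fullE S : (full S)%:R = (missing S == 0)%:R :> R.
Proof.
congr (nat_of_bool _)%:R.
by rewrite /missing pnatr_eq0 cards_eq0 /full -finset.setCT (inj_eq (@finset.setC_inj _)).
Qed.

(** First-moment bound: [1 - z <= 1_{z = 0}] for the number [z] of missing coupons, whose mean is
    [m r^n]. *)
Lemma all_seen_ge n : 1 - m%:R * r ^+ n <= all_seen n.
Proof.
have h S : 1 + -1 * missing S + 0 * (missing S * (missing S - 1)) <= (full S)%:R.
  rewrite fullE mul0r addr0 mulN1r; case: eqP => [->|/eqP]; first by rewrite subr0.
  by rewrite /missing pnatr_eq0 -lt0n subr_le0 ler1n.
have := le_iter_transition n finset.set0 in01 h.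
by rewrite iter_transition_missing missing0 mul0r addr0 mulN1r mulrC.
Qed.

Let r_gt0 : 0 < r.
Proof. by rewrite subr_gt0 invf_lt1 ?ltr0n // ltr1n. Qed.

(* Chebyshev's inequality for the number of missing coupons, in the form
   [z = 0 -> 1 <= (1 - z / mu)^2] with [mu] the mean. *)
Lemma all_seen_le n : all_seen n <= (m%:R * r ^+ n)^-1.
Proof.
set mu := m%:R * r ^+ n.
have mu_gt0 : 0 < mu by rewrite mulr_gt0 ?exprn_gt0 // ltr0n.
have mu0 : mu != 0 by rewrite gt_eqF.
have h S : (full S)%:R <= 1 + (mu ^- 2 - 2 / mu) * missing S
    + mu ^- 2 * (missing S * (missing S - 1)).
  have -> : 1 + (mu ^- 2 - 2 / mu) * missing S
    + mu ^- 2 * (missing S * (missing S - 1)) = (1 - missing S / mu) ^+ 2.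
    by field.
  rewrite fullE; case: eqP => [->|_]; last exact: sqr_ge0.
  by rewrite mul0r subr0 expr1n.
apply: le_trans (le_iter_transition n finset.set0 in01 h) _.
rewrite iter_transition_missing missing0.
(* Since [1 - 2/m <= (1 - 1/m)^2], the second factorial moment is at most [mu^2]. *)
have s_le : (1 - 2 / m%:R) ^+ n <= (r ^+ n) ^+ 2.
  rewrite -exprM mulnC exprM lerXn2r ?nnegrE ?sqr_ge0 //.
    by rewrite subr_ge0 ler_pdivrMr ?ltr0n // mul1r.
  have -> : r ^+ 2 = 1 - 2 / m%:R + m%:R^-2 by rewrite /r; field.
  by rewrite lerDl invr_ge0 sqr_ge0.
have s_ge : 0 <= (1 - 2 / m%:R : R) ^+ n.
  by rewrite exprn_ge0 // subr_ge0 ler_pdivrMr ?ltr0n // mul1r.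
rewrite (mulrC (r ^+ n)) -/mu.
have e : (1 - 2 / m%:R) ^+ n * (m%:R * (m%:R - 1)) <= mu ^+ 2.
  rewrite /mu exprMn mulrC ler_pM //.
    by rewrite mulr_ge0 ?ler0n // subr_ge0 ler1n.
  by rewrite expr2 ler_wpM2l ?ler0n // gerBl.
have : mu ^- 2 * ((1 - 2 / m%:R) ^+ n * (m%:R * (m%:R - 1))) <= 1.
  by rewrite mulrC ler_pdivrMr ?exprn_gt0 // mul1r.
suff -> : 1 + (mu ^- 2 - 2 / mu) * mu = mu^-1 - 1 by lra.
by field.
Qed.

(** Sums the geometric bounds of [all_seen_le]; the induction step rests on
    [(1 + 1/m) r = 1 - 1/m^2 <= 1]. *)
Lemma sum_all_seen_le N : \sum_(n < N.+1) all_seen n <= r ^- N.+1.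
Proof.
elim: N => [|N IH].
  rewrite big_ord1 expr1; apply: le_trans (all_seen_le 0) _.
  rewrite expr0 mulr1 lef_pV2 ?posrE ?ltr0n //.
  have : 0 < m%:R^-1 :> R by rewrite invr_gt0 ltr0n.
  by have := m2; rewrite /r; lra.
rewrite big_ord_recr /=; apply: le_trans (lerD IH (all_seen_le _)) _.
have rN : 0 < r ^+ N.+1 by rewrite exprn_gt0.
rewrite invfM -{1}[(r ^+ N.+1)^-1]mul1r -mulrDl [r ^+ N.+2]exprS invfM.
rewrite ler_wpM2r ?invr_ge0 ?(ltW rN) // -[leRHS]mul1r ler_pdivlMr //.
have : 0 <= m%:R^-1 ^+ 2 :> R by exact: sqr_ge0.
by rewrite /r expr2; lra.
Qed.
End coupon_collector.

(** * Inverse moments of the binomial law *)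

Section binomial_moments.
Variables (R : realFieldType) (m : nat) (p : R).
Hypothesis p01 : 0 < p < 1.

Let p0 : p != 0. Proof. by case/andP: p01 => /lt0r_neq0. Qed.
Let q_ge0 : 0 <= 1 - p. Proof. by case/andP: p01 => _ /ltW; rewrite subr_ge0. Qed.

Lemma sum_card_set (g : nat -> R) :
  \sum_(B : {set 'I_m}) g #|B| = \sum_(k < m.+1) g k *+ 'C(m, k).
Proof.
have cB (B : {set 'I_m}) : (#|B| < m.+1)%N.
  by rewrite ltnS -[leqRHS]card_ord max_card.
rewrite (partition_big (fun B : {set 'I_m} => Ordinal (cB B)) xpredT) //=.
apply: eq_bigr => k _.
rewrite (eq_bigr (fun=> g k)) => [|B /eqP <- //].
rewrite sumr_const; congr (_ *+ _).
have := card_draws 'I_m k; rewrite card_ord => <-.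
by apply: eq_card => B; rewrite !inE.
Qed.

(** Probability of one given set of [k] coupons when each coupon is retained independently with
    probability [p]. *)
Definition weight (k : nat) : R := (1 - p) ^+ (m - k) * p ^+ k.

(** The identity [C(m, k) / (k + 1) = C(m + 1, k + 1) / (m + 1)] turns [E [1 / (K + 1)]] into the
    binomial expansion of order [m + 1] without its first term. *)
Lemma sum_weight_inv1 :
  \sum_(B : {set 'I_m}) weight #|B| / #|B|.+1%:R =
  (1 - (1 - p) ^+ m.+1) / (m.+1%:R * p).
Proof.
rewrite (sum_card_set (fun k => weight k / k.+1%:R)).
have -> : 1 - (1 - p) ^+ m.+1 =
    \sum_(k < m.+1) (1 - p) ^+ (m - k) * p ^+ k.+1 *+ 'C(m.+1, k.+1).
  have := exprDn (1 - p) p m.+1; rewrite addrNK expr1n big_ord_recl /=.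
  by rewrite subn0 expr0 mulr1 bin0 mulr1n => {1}->; rewrite addrC addKr.
rewrite mulr_suml; apply: eq_bigr => k _.
have := mul_bin_diag m.+1 k => /(congr1 (fun n : nat => n%:R : R)) /=.
rewrite !natrM => e.
rewrite -[LHS]mulr_natl -[X in _ = X / _]mulr_natl /weight exprSr.
have -> : 'C(m.+1, k.+1)%:R = m.+1%:R * 'C(m, k)%:R / k.+1%:R :> R.
  by rewrite e mulrAC divff ?mul1r // pnatr_eq0.
have k0 : k.+1%:R != 0 :> R by rewrite pnatr_eq0.
have m0 : m.+1%:R != 0 :> R by rewrite pnatr_eq0.
move: (k.+1%:R) (m.+1%:R) k0 m0 => a b a0 b0.
by field; rewrite p0 a0 b0.
Qed.

(** The same identity used twice gives the expansion of order [m + 2] without its first two terms,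
    which are nonnegative. *)
Lemma sum_weight_inv2 :
  \sum_(B : {set 'I_m}) weight #|B| / (#|B|.+1%:R * #|B|.+2%:R) <=
  1 / (m.+1%:R * m.+2%:R * p ^+ 2).
Proof.
rewrite (sum_card_set (fun k => weight k / (k.+1%:R * k.+2%:R))).
have : \sum_(k < m.+1) (1 - p) ^+ (m - k) * p ^+ k.+2 *+ 'C(m.+2, k.+2) <= 1.
  have := exprDn (1 - p) p m.+2; rewrite addrNK expr1n big_ord_recl big_ord_recl /=.
  move=> {2}->; rewrite addrA lerDr addr_ge0 //.
    by rewrite mulrn_wge0 // mulr_ge0 ?exprn_ge0 //; case/andP: p01 => /ltW.
  by rewrite mulrn_wge0 // mulr_ge0 ?exprn_ge0 //; case/andP: p01 => /ltW.
rewrite -(@ler_pM2r _ (m.+1%:R * m.+2%:R * p ^+ 2)^-1); last first.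
  by rewrite invr_gt0 !mulr_gt0 ?ltr0n ?exprn_gt0 //; case/andP: p01.
apply: le_trans; rewrite mulr_suml le_eqVlt; apply/orP; left; apply/eqP.
apply: eq_bigr => k _.
have := mul_bin_diag m.+1 k => /(congr1 (fun n : nat => n%:R : R)) /=.
have := mul_bin_diag m.+2 k.+1 => /(congr1 (fun n : nat => n%:R : R)) /=.
rewrite !natrM => e2 e1.
rewrite -[LHS]mulr_natl -[X in _ = X / _]mulr_natl /weight.
have -> : 'C(m.+2, k.+2)%:R = m.+2%:R * (m.+1%:R * 'C(m, k)%:R / k.+1%:R) / k.+2%:R :> R.
  rewrite e1 [k.+1%:R * _]mulrC mulfK ?pnatr_eq0 //.
  by rewrite e2 [k.+2%:R * _]mulrC mulfK ?pnatr_eq0.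
have k0 : k.+1%:R != 0 :> R by rewrite pnatr_eq0.
have m0 : m.+1%:R != 0 :> R by rewrite pnatr_eq0.
have k0' : k.+2%:R != 0 :> R by rewrite pnatr_eq0.
have m0' : m.+2%:R != 0 :> R by rewrite pnatr_eq0.
move: (k.+1%:R) (m.+1%:R) (k.+2%:R) (m.+2%:R) k0 m0 k0' m0' => a b c e a0 b0 c0 e0.
by rewrite !exprS; field; rewrite p0 a0 b0 c0 e0.
Qed.

End binomial_moments.

(** * Renewal identity and Euler schemes *)

Section renewal.
Variables (R : realFieldType) (m : nat) (p : R).
Hypotheses (m_gt1 : (1 < m)%N) (p01 : 0 < p < 1).

Let m_gt0 : (0 < m)%N := ltnW m_gt1.
Let m0 : m%:R != 0 :> R. Proof. by rewrite pnatr_eq0 -lt0n. Qed.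
Let p_gt0 : 0 < p. Proof. by case/andP: p01. Qed.
Let p_lt1 : p < 1. Proof. by case/andP: p01. Qed.
Let p01w : 0 <= p <= 1. Proof. by rewrite !ltW. Qed.
Let r : R := 1 - m%:R^-1.
Let stat : R := (1 - p) ^+ m.
Let F (N : nat) : R := hit p N (finset.set0 : {set 'I_m}).
Let q (n : nat) : R := all_seen R m n.
Let v (n : nat) : R := full_at p n [set: 'I_m]%SET.

(* Excess expected number of visits to the full state before time [J], started
   from it, over stationarity. *)
Definition excess J : R := \sum_(j < J) (v j - stat).

(* The limit of [p * excess J], i.e. [E (m p / K)] over the nonzero values of a
   binomial [K]. *)
Definition excess_limit : R :=
  p * \sum_(B : {set 'I_m} | (0 < #|B|)%N) weight m p #|B| * (m%:R / #|B|%:R).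

Let weight_ge0 k : 0 <= weight m p k.
Proof. by apply: mulr_ge0; apply: exprn_ge0; rewrite ?subr_ge0 ltW. Qed.

Let card_le (B : {set 'I_m}) : (#|B| <= m)%N.
Proof. by rewrite -[leqRHS]card_ord max_card. Qed.

Let ratio_ge0 (B : {set 'I_m}) : 0 <= 1 - #|B|%:R / m%:R :> R.
Proof. by rewrite subr_ge0 ler_pdivrMr ?ltr0n // mul1r ler_nat. Qed.

(** The empty set contributes exactly [stat]; only decaying modes remain, all nonnegative. *)
Let v_sub n : v n - stat =
  \sum_(B : {set 'I_m} | (0 < #|B|)%N) weight m p #|B| * (1 - #|B|%:R / m%:R) ^+ n.
Proof.
rewrite /v full_at_setT // (bigID (fun B : {set 'I_m} => (0 < #|B|)%N)) /=.
rewrite [X in _ + X - _](big_pred1 finset.set0) => [|B]; last first.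
  by rewrite -eqn0Ngt cards_eq0.
by rewrite cards0 subn0 mul0r subr0 expr1n expr0 !mulr1 addrK.
Qed.

Let v_ge n : stat <= v n.
Proof.
rewrite -subr_ge0 v_sub; apply: sumr_ge0 => B _.
by rewrite mulr_ge0 ?exprn_ge0.
Qed.

(** Each mode is summed as a geometric series of ratio [1 - #|B| / m]. *)
Lemma excessE J : p * excess J = p *
  \sum_(B : {set 'I_m} | (0 < #|B|)%N)
    weight m p #|B| * (m%:R / #|B|%:R) * (1 - (1 - #|B|%:R / m%:R) ^+ J).
Proof.
congr (_ * _); rewrite /excess; under eq_bigr do rewrite v_sub.
rewrite exchange_big /=; apply: eq_bigr => B B0.
rewrite -mulr_sumr -mulrA; congr (_ * _).
have b0 : #|B|%:R != 0 :> R by rewrite pnatr_eq0 -lt0n.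
set x := 1 - _ / _.
have -> : m%:R / #|B|%:R * (1 - x ^+ J) =
    - (x - 1) * (m%:R / #|B|%:R) * \sum_(i < J) x ^+ i.
  by rewrite -[1 - x ^+ J]opprB subrX1; ring.
rewrite -[LHS]mul1r; congr (_ * _).
by rewrite /x; field; rewrite b0 m0.
Qed.

Lemma excess_le J : p * excess J <= excess_limit.
Proof.
rewrite excessE /excess_limit ler_pM2l //; apply: ler_sum => B B0.
rewrite -[leRHS]mulr1 ler_wpM2l ?gerBl ?exprn_ge0 //.
by apply: mulr_ge0 => //; exact: divr_ge0.
Qed.

(** The slowest mode has [#|B| = 1] and ratio [r], so every mode has reached at least the fraction
    [1 - r^J] of its limit. *)
Lemma excess_ge J : (1 - r ^+ J) * excess_limit <= p * excess J.
Proof.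
rewrite excessE /excess_limit mulrCA ler_pM2l // mulr_sumr; apply: ler_sum => B B0.
rewrite mulrC ler_wpM2l ?lerB //; first by apply: mulr_ge0 => //; exact: divr_ge0.
rewrite lerXn2r ?nnegrE //; last by rewrite lerB // ler_pdivlMr ?ltr0n // mulVf // ler1n.
by rewrite subr_ge0 invf_le1 ?ltr0n // ler1n.
Qed.

Lemma excess_ge0 J : 0 <= excess J.
Proof. by apply: sumr_ge0 => j _; rewrite subr_ge0. Qed.

Lemma excess_mono : {homo excess : i j / (i <= j)%N >-> i <= j}.
Proof.
move=> i j /subnK <-; elim: (j - i)%N => // n /le_trans; apply.
by rewrite addSn /excess big_ord_recr /= lerDl subr_ge0.
Qed.

(** The [Y_N] of the overview. By [full_at_set0], [stat * q n] is the probability of being at the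
    full set at time [n]. *)
Definition deficit N : R := p * stat * \sum_(n < N) (q n - F n).

Lemma deficitS N : deficit N.+1 = deficit N + p * stat * (q N - F N).
Proof. by rewrite /deficit big_ord_recr /= mulrDr. Qed.

(** By [first_passage], [stat * q N] is the sum of the [first_at k] times [v (N - k)], and
    [stat * F N] that of the [first_at k] times [stat]. The differences [v (N - k) - stat] are the
    increments of the [excess] terms. *)
Lemma deficitE N :
  deficit N = p * \sum_(k < N) first_at p k (finset.set0 : {set 'I_m}) * excess (N - k).
Proof.
elim: N => [|N IH]; first by rewrite /deficit !big_ord0 !mulr0.
rewrite deficitS IH -mulrA -mulrDr mulrBr; congr (_ * _).
rewrite /q /all_seen -full_at_set0 // first_passage /F /hit mulr_sumr -sumrB.
have -> : \sum_(k < N) first_at p k (finset.set0 : {set 'I_m}) * excess (N - k) =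
   \sum_(k < N.+1) first_at p k (finset.set0 : {set 'I_m}) * excess (N - k).
  by rewrite big_ord_recr /= subnn /excess big_ord0 mulr0 addr0.
rewrite -big_split /=; apply: eq_bigr => k _.
rewrite subSn ?[in RHS]/excess ?big_ord_recr /= -/(excess _) -?/(v _);
  last by rewrite -ltnS.
by rewrite -/stat; ring.
Qed.

Let f_ge0 k : 0 <= first_at p k (finset.set0 : {set 'I_m}).
Proof. exact: first_at_ge0. Qed.

Let F_ge0 N : 0 <= F N. Proof. exact: hit_ge0. Qed.

Lemma deficit_le N : deficit N.+1 <= excess_limit * F N.
Proof.
rewrite deficitE mulr_sumr mulr_sumr; apply: ler_sum => k _.
by rewrite mulrCA mulrC ler_wpM2r // excess_le.
Qed.

(** First visits up to time [N] leave at least [J] further steps, so their excess is at least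
    [excess J]; later ones contribute nonnegative terms. *)
Lemma deficit_ge J N : p * excess J * F N <= deficit (N + J).
Proof.
rewrite deficitE -mulrA ler_pM2l //.
have -> : \sum_(k < N + J) first_at p k (finset.set0 : {set 'I_m}) * excess (N + J - k) =
   \sum_(k < (N + J).+1) first_at p k (finset.set0 : {set 'I_m}) * excess (N + J - k).
  by rewrite big_ord_recr /= subnn /excess big_ord0 mulr0 addr0.
rewrite -addSn /F /hit mulr_sumr big_split_ord /= -[leLHS]addr0 lerD //.
  apply: ler_sum => k _; rewrite mulrC ler_wpM2l // excess_mono //.
  by rewrite addnC -addnBA ?leq_addr // -ltnS.
by apply: sumr_ge0 => k _; apply: mulr_ge0; [exact: (f_ge0 (N.+1 + k))|exact: excess_ge0].
Qed.

Lemma deficit_ge0 N : 0 <= deficit N.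
Proof.
rewrite deficitE; apply: mulr_ge0; first exact: ltW.
apply: sumr_ge0 => k _.
by apply: mulr_ge0; [exact: f_ge0|exact: excess_ge0].
Qed.

Lemma deficit_mono N : deficit N <= deficit N.+1.
Proof.
rewrite !deficitE ler_pM2l // big_ord_recr /= -[leLHS]addr0.
apply: lerD; last exact: mulr_ge0 (f_ge0 _) (excess_ge0 _).
by apply: ler_sum => k _; rewrite ler_wpM2l // excess_mono // leq_sub2r.
Qed.

Let stat_gt0 : 0 < stat. Proof. by rewrite exprn_gt0 // subr_gt0. Qed.
Let dp_gt0 : 0 < p * stat. Proof. exact: mulr_gt0. Qed.

Lemma deficit_le_sum N : deficit N <= p * stat * \sum_(n < N) q n.
Proof. by rewrite ler_pM2l //; apply: ler_sum => n _; rewrite gerBl. Qed.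

Lemma deficit_le_add N J : deficit (N + J) <= deficit N + p * stat * J%:R.
Proof.
elim: J => [|J IH]; first by rewrite addn0 mulr0 addr0.
rewrite addnS deficitS -natr1 [in leRHS]mulrDr mulr1 addrA lerD // ger_pMr //.
by rewrite lerBlDr (le_trans (all_seen_le1 _ _ _)) // lerDl.
Qed.

(** Write [alpha] for [excess_limit] and [delta] for [p * stat]. From [F_n >= Y_{n+1} / alpha] and
    [q_n <= 1] follows the implicit Euler inequality [Y_{n+1} <= Y_n + delta (1 - Y_{n+1} / alpha)]:
    a step divides the gap [alpha - Y] by at most [1 + delta / alpha]. *)
Lemma hit_upper J N0 n N : (N0 + n = N + J)%N -> 0 < excess_limit ->
  p * excess J * F N <=
  excess_limit - (excess_limit - deficit N0) / (1 + p * stat / excess_limit) ^+ n.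
Proof.
move=> e a_gt0; have c_gt0 : 0 < 1 + p * stat / excess_limit.
  by rewrite ltr_pwDl // ltW // divr_gt0.
apply: le_trans (deficit_ge J N) _; rewrite -{}e lerBrDr addrC -lerBrDr.
elim: n => [|n IH]; first by rewrite addn0 expr0 divr1.
rewrite exprSr invfM mulrA ler_pdivrMr //; apply: le_trans IH _.
rewrite addnS mulrDr mulr1; have := deficitS (N0 + n).
have := deficit_le (N0 + n); rewrite mulrC -ler_pdivrMr // => dF.
have := all_seen_le1 R m_gt1 (N0 + n); rewrite -/(q _) => q1 dS.
have : deficit (N0 + n).+1 <=
    deficit (N0 + n) + p * stat * (1 - deficit (N0 + n).+1 / excess_limit).
  by rewrite {1}dS lerD2l ler_pM2l // lerB.
rewrite [in X in _ -> X]mulrBl mulrCA mulfV ?gt_eqF // mulr1 mulrBr mulr1.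
have -> : deficit (N0 + n).+1 * (p * stat / excess_limit) =
  p * stat * (deficit (N0 + n).+1 / excess_limit) by ring.
by move=> le_t; rewrite -addrA lerD2l -lerBlDr -opprD lerN2.
Qed.

(** The opposite scheme, started from [Y_M >= 0] at a time [M] from which [q] is at least
    [1 - m r^M]. Its fixed point is [k], and [(k - Y_{n+1}) (1 + delta / b) <= k - Y_n]. *)
Lemma hit_lower J M n : 0 < p * excess J.+1 ->
  (p * excess J.+1 * (1 - m%:R * r ^+ M) - p * stat * J%:R) *
     (1 - (1 + p * stat / (p * excess J.+1)) ^- n) <= excess_limit * F (M + n).
Proof.
set b := p * excess J.+1; set k := b * _ - _ => b_gt0.
have c_gt0 : 0 < 1 + p * stat / b by rewrite ltr_pwDl // ltW // divr_gt0.
suff : k - deficit (M + n) <= k / (1 + p * stat / b) ^+ n.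
  move=> h; apply: le_trans (deficit_le _); rewrite mulrBr mulr1.
  by have := deficit_mono (M + n); move: h; lra.
elim: n => [|n IH]; first by rewrite addn0 expr0 divr1 gerBl deficit_ge0.
rewrite exprSr invfM mulrA ler_pdivlMr //; apply: le_trans IH.
rewrite addnS mulrDr mulr1.
have qM : 1 - m%:R * r ^+ M <= q (M + n).
  apply: le_trans (all_seen_ge R m_gt1 (M + n)); rewrite lerB // ler_wpM2l ?ler0n //.
  rewrite exprD ger_pMr ?exprn_gt0 ?exprn_ile1 //
    /r ?subr_ge0 ?subr_gt0 ?gerBl ?invr_ge0 //.
    by rewrite invf_le1 ?ltr0n // ler1n.
  by rewrite invf_lt1 ?ltr0n // ltr1n.
(* [deficit_ge] involves the deficit [J] steps too late; each of these steps adds at most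
   [p * stat]. *)
have FN : F (M + n) <= (deficit (M + n).+1 + p * stat * J%:R) / b.
  rewrite ler_pdivlMr // mulrC; apply: le_trans (deficit_ge _ _) _.
  by rewrite addnS -addSn deficit_le_add.
have dS := deficitS (M + n).
have -> : (k - deficit (M + n).+1) * (p * stat / b) =
   p * stat * (1 - m%:R * r ^+ M) -
   p * stat * ((deficit (M + n).+1 + p * stat * J%:R) / b).
  by rewrite /k; field; rewrite gt_eqF.
have : deficit (M + n) + p * stat * ((1 - m%:R * r ^+ M) -
   ((deficit (M + n).+1 + p * stat * J%:R) / b)) <= deficit (M + n).+1.
  by rewrite [leRHS]dS lerD2l ler_pM2l // lerB.
rewrite mulrBr => le_t.
rewrite -addrA lerD2l -[leRHS]sub0r lerBrDr -addrA.
by rewrite (addrC _ (deficit (M + n))) addrC subr_le0.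
Qed.
Let weight0 : weight m p 0 = stat.
Proof. by rewrite /weight subn0 expr0 mulr1. Qed.

Let sum_weight_pos (g : nat -> R) :
  \sum_(B : {set 'I_m} | (0 < #|B|)%N) weight m p #|B| * g #|B| =
  \sum_(B : {set 'I_m}) weight m p #|B| * g #|B| - stat * g 0.
Proof.
rewrite [in RHS](bigID (fun B : {set 'I_m} => (0 < #|B|)%N)) /=.
rewrite [X in _ = _ + X - _](big_pred1 finset.set0) => [|B]; last first.
  by rewrite -eqn0Ngt cards_eq0.
by rewrite cards0 weight0 addrK.
Qed.

Let excess_limitE : excess_limit = p * m%:R *
  (\sum_(B : {set 'I_m} | (0 < #|B|)%N) weight m p #|B| * #|B|%:R^-1).
Proof.
rewrite /excess_limit -mulrA; congr (_ * _); rewrite mulr_sumr.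
by apply: eq_bigr => B _; rewrite mulrCA.
Qed.

(** Uses [1 / K >= 1 / (K + 1)] for [K > 0]; removing the value [K = 0] from the explicit mean costs
    [m p * stat]. *)
Lemma excess_limit_ge : 1 - m%:R^-1 - (1 + m%:R * p) * stat <= excess_limit.
Proof.
rewrite excess_limitE.
apply: (@le_trans _ _ (p * m%:R * (\sum_(B : {set 'I_m} | (0 < #|B|)%N)
    weight m p #|B| * #|B|.+1%:R^-1))); last first.
  rewrite ler_pM2l ?mulr_gt0 ?ltr0n //; apply: ler_sum => B B0.
  by rewrite ler_wpM2l // lef_pV2 ?posrE ?ltr0n // ler_nat.
rewrite (sum_weight_pos (fun k => k.+1%:R^-1)) sum_weight_inv1 // invr1 mulr1.
have m1 : m.+1%:R != 0 :> R by rewrite pnatr_eq0.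
have -> : p * m%:R * ((1 - (1 - p) ^+ m.+1) / (m.+1%:R * p) - stat) =
  1 - m.+1%:R^-1 - (1 - m.+1%:R^-1) * (1 - p) ^+ m.+1 - m%:R * p * stat.
  have -> : m%:R = m.+1%:R - 1 :> R by rewrite -natr1 addrK.
  by move: (m.+1%:R) m1 => c c0; field; rewrite c0 gt_eqF.
have h1 : m.+1%:R^-1 <= m%:R^-1 :> R by rewrite lef_pV2 ?posrE ?ltr0n // ler_nat.
have h0 : 0 <= m.+1%:R^-1 :> R by rewrite invr_ge0 ler0n.
have h2 : (1 - m.+1%:R^-1) * (1 - p) ^+ m.+1 <= stat.
  rewrite exprS mulrA ger_pMl //.
  have h3 : m.+1%:R^-1 <= 1 :> R by rewrite invf_le1 ?ltr0n // ler1n.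
  apply: mulr_ile1; rewrite ?subr_ge0 ?gerBl //; exact: ltW.
rewrite mulrDl mul1r opprD addrA lerD2r lerB // lerB //.
Qed.

(** Uses [1 / k <= 1 / (k + 1) + 3 / ((k + 1) (k + 2))] for [k >= 1], an equality at [k = 1], which
    reduces the mean of [1 / K] to the two inverse moments. *)
Lemma excess_limit_le : excess_limit <= 1 + 3 / (m%:R * p).
Proof.
rewrite excess_limitE.
apply: (@le_trans _ _ (p * m%:R *
   (\sum_(B : {set 'I_m}) weight m p #|B| / #|B|.+1%:R +
    3 * \sum_(B : {set 'I_m}) weight m p #|B| / (#|B|.+1%:R * #|B|.+2%:R)))).
  rewrite ler_pM2l ?mulr_gt0 ?ltr0n //.
  rewrite mulr_sumr -big_split /= [leRHS](bigID (fun B : {set 'I_m} => (0 < #|B|)%N)) /=.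
  rewrite -[leLHS]addr0; apply: lerD; last first.
    apply: sumr_ge0 => B _; apply: addr_ge0; first exact: divr_ge0.
    by apply: mulr_ge0 => //; apply: divr_ge0 => //; exact: mulr_ge0.
  apply: ler_sum => B B0; rewrite mulrCA -mulrDr ler_wpM2l //.
  have k1 : 1 <= #|B|%:R :> R by rewrite ler1n.
  rewrite -(natr1 #|B|.+1) -(natr1 #|B|); move: (#|B|%:R : R) k1 => k k1.
  have k0 : k != 0 by rewrite gt_eqF //; lra.
  have k0' : k + 1 != 0 by rewrite gt_eqF //; lra.
  have k0'' : k + 1 + 1 != 0 by rewrite gt_eqF //; lra.
  have -> : (k + 1)^-1 + 3 / ((k + 1) * (k + 1 + 1)) = (k + 5) / ((k + 1) * (k + 1 + 1)).
    by field; rewrite k0' k0''.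
  rewrite ler_pdivlMr; last by apply: mulr_gt0; lra.
  rewrite mulrC ler_pdivrMr; last by lra.
  by nra.
rewrite mulrDr; apply: lerD.
  rewrite sum_weight_inv1 //.
  have -> : p * m%:R * ((1 - (1 - p) ^+ m.+1) / (m.+1%:R * p)) =
      m%:R / m.+1%:R * (1 - (1 - p) ^+ m.+1).
    have : m.+1%:R != 0 :> R by rewrite pnatr_eq0.
    by move: (m.+1%:R) => c c0; field; rewrite c0 gt_eqF.
  apply: mulr_ile1; rewrite ?gerBl ?subr_ge0 ?exprn_ge0 ?exprn_ile1 ?divr_ge0 ?ler0n //;
    rewrite ?subr_ge0 ?gerBl; try exact: ltW.
  by rewrite ler_pdivrMr ?ltr0n // mul1r ler_nat.
apply: (@le_trans _ _ (p * m%:R * (3 * (1 / (m.+1%:R * m.+2%:R * p ^+ 2))))).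
  rewrite ler_pM2l ?mulr_gt0 ?ltr0n // ler_pM2l ?ltr0n //; exact: sum_weight_inv2.
have -> : p * m%:R * (3 * (1 / (m.+1%:R * m.+2%:R * p ^+ 2))) =
    3 / (m%:R * p) * (m%:R / m.+1%:R * (m%:R / m.+2%:R)).
  have : m.+1%:R != 0 :> R by rewrite pnatr_eq0.
  have : m.+2%:R != 0 :> R by rewrite pnatr_eq0.
  by move: (m.+1%:R) (m.+2%:R) => c e c0 e0; field; rewrite m0 c0 e0 gt_eqF.
rewrite ger_pMr; last by rewrite divr_gt0 ?mulr_gt0 ?ltr0n.
apply: mulr_ile1; rewrite ?divr_ge0 ?ler0n //.
  by rewrite ler_pdivrMr ?ltr0n // mul1r ler_nat.
by rewrite ler_pdivrMr ?ltr0n // mul1r ler_nat ltnW.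
Qed.

End renewal.

(** * Explicit exponential bounds on the hitting probabilities *)

Section hit_bounds.
Variables (R : realType) (m : nat) (p : R).
Hypotheses (m_gt1 : (1 < m)%N) (p01 : 0 < p < 1).

Let m_gt0 : (0 < m)%N := ltnW m_gt1.
Let mR_gt0 : 0 < m%:R :> R. Proof. by rewrite ltr0n. Qed.
Let mR_gt1 : 1 < m%:R :> R. Proof. by rewrite ltr1n. Qed.
Let p_gt0 : 0 < p. Proof. by case/andP: p01. Qed.
Let p_lt1 : p < 1. Proof. by case/andP: p01. Qed.
Let mp_gt0 : 0 < m%:R * p. Proof. exact: mulr_gt0. Qed.
Let r : R := 1 - m%:R^-1.
Let rate : R := p * (1 - p) ^+ m.
Let rate_gt0 : 0 < rate. Proof. by rewrite mulr_gt0 // exprn_gt0 // subr_gt0. Qed.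
Let F (N : nat) : R := hit p N (finset.set0 : {set 'I_m}).
Let a : R := excess_limit m p.

Let r_gt0 : 0 < r. Proof. by rewrite subr_gt0 invf_lt1 // ltr1n. Qed.

Let truncn_gt (y : R) : 0 <= y -> y < (Num.truncn y)%:R + 1.
Proof. by move=> /truncn_itv /andP[_]; rewrite natr1. Qed.

Lemma ratio_exp_le (n : nat) (y : R) : y * m%:R <= n%:R -> r ^+ n <= expR (- y).
Proof.
move=> yn; apply: (@le_trans _ _ (expR (n%:R * - m%:R^-1))).
  rewrite expRM_natl lerXn2r ?nnegrE ?expR_ge0 ?expR_ge1Dx //.
  exact: ltW.
by rewrite ler_expR mulrN lerN2 ler_pdivlMr.
Qed.

(** Here [1 / r = 1 + 1 / (m - 1) <= exp (1 / (m - 1))], whence the time [(m - 1) log m] in place of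
    [m log m]. *)
Lemma ratio_exp_ge (n : nat) : n%:R <= (m%:R - 1) * ln (m%:R : R) -> r ^- n <= m%:R :> R.
Proof.
move=> nm; have m1 : 0 < m%:R - 1 :> R by rewrite subr_gt0.
have -> : r ^- n = (1 + (m%:R - 1)^-1) ^+ n.
  rewrite -exprVn; congr (_ ^+ _); rewrite /r; field.
  by rewrite !gt_eqF //; do ?[apply/andP; split] => //; rewrite gt_eqF.
apply: (@le_trans _ _ (expR (n%:R * (m%:R - 1)^-1))).
  rewrite expRM_natl lerXn2r ?nnegrE ?expR_ge0 ?expR_ge1Dx //.
  by rewrite addr_ge0 // invr_ge0 ltW.
rewrite -[leRHS]lnK ?posrE // ler_expR ler_pdivrMr // mulrC //.
Qed.

Let lnm_ge0 : 0 <= ln (m%:R : R) :> R. Proof. by rewrite ln_ge0 // ltW. Qed.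

Let lnm_le : ln (m%:R : R) <= m%:R - 1 :> R.
Proof.
by have := @le_ln1Dx R (m%:R - 1); rewrite (addrC 1) subrK ltrBrDr addNr; exact.
Qed.

(** [rate] times an allowance [m (m p) + 2 m] for all shifts in time: windows of length about
    [m (m p)], roundings, and the gap between [m log m] and [(m - 1) log m]. *)
Let slack : R := rate * m%:R * (m%:R * p + 2).

Let slack_ge (c : R) : c <= m%:R * (m%:R * p) + 2 * m%:R -> rate * c <= slack.
Proof. by move=> h; rewrite /slack -mulrA ler_pM2l // mulrDr [m%:R * 2]mulrC. Qed.

Lemma hit_exp_upper (x : R) N : 0 <= x -> N%:R <= m%:R * ln (m%:R : R) + x / rate ->
  (Num.truncn ((m%:R - 1) * ln (m%:R : R)) <= N)%N ->
  rate * m%:R <= a -> 0 < a ->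
  (1 - expR (- (m%:R * p))) * a * F N <=
  a - (a - rate * m%:R) * expR (- ((x + slack) / a)).
Proof.
(* Up to [N0] the sum of the [q_n] is still at most [m]. The window [J >= m (m p)] gives
   [r^J <= exp (- m p)], so [excess J] is close to its limit. *)
move=> x_ge0 N_le N_ge dm_le a_gt0.
set N0 := Num.truncn _ in N_ge; set J := (Num.truncn (m%:R * (m%:R * p) : R)).+1.
have J_gt : m%:R * (m%:R * p) <= J%:R.
  by rewrite /J -natr1 ltW // truncn_gt // mulr_ge0 ?ltW.
have J_le : J%:R <= m%:R * (m%:R * p) + 1.
  by rewrite /J -natr1 lerD2r truncn_le mulr_ge0 ?ltW.
have N0_ge : (m%:R - 1) * ln (m%:R : R) - 1 <= N0%:R.
  by rewrite lerBlDr ltW // truncn_gt // mulr_ge0 // subr_ge0 ltW.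
have N0_le : N0%:R <= (m%:R - 1) * ln (m%:R : R) :> R.
  by rewrite truncn_le mulr_ge0 // subr_ge0 ltW.
have NJ : (N0 + (N + J - N0) = N + J)%N by rewrite subnKC // (leq_trans N_ge) ?leq_addr.
have := hit_upper m_gt1 p01 NJ a_gt0; rewrite -/rate -/a -/(F N); set n := (_ - N0)%N.
have nE : n%:R = N%:R + J%:R - N0%:R :> R.
  by rewrite natrB ?natrD // (leq_trans N_ge) ?leq_addr.
have exc : (1 - expR (- (m%:R * p))) * a <= p * excess m p J.
  apply: le_trans (excess_ge m_gt1 p01 J); rewrite ler_pM2r // lerB //.
  by apply: ratio_exp_le; rewrite mulrC.
have Y0 : deficit m p N0 <= rate * m%:R.
  apply: le_trans (deficit_le_sum m_gt1 p01 N0) _; rewrite -/rate ler_pM2l //.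
  apply: le_trans (ratio_exp_ge N0_le); have := sum_all_seen_le R m_gt1 N0.-1.
  case: (N0) => [|k] //= _; by rewrite big_ord0 expr0 invr1.
(* The number of Euler steps exceeds [x / rate] by at most [log m + m (m p) + 2], and
   [log m <= m - 1]. *)
have dn : rate * n%:R <= x + slack.
  have dx : rate * (x / rate) = x by rewrite mulrC divfK // gt_eqF.
  rewrite -{1}dx -lerBlDl -mulrBr; apply: slack_ge.
  by have := mR_gt1; have := lnm_le; rewrite nE; lra.
have pow : expR (- ((x + slack) / a)) <= (1 + rate / a) ^- n.
  have c_gt0 : 0 < 1 + rate / a by rewrite addr_gt0 ?divr_gt0.
  rewrite expRN lef_pV2 ?posrE ?expR_gt0 ?exprn_gt0 //.
  apply: (@le_trans _ _ (expR (n%:R * (rate / a)))).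
    rewrite expRM_natl lerXn2r ?nnegrE ?expR_ge0 ?expR_ge1Dx //.
    exact: ltW.
  by rewrite ler_expR mulrA ler_pM2r ?invr_gt0 // mulrC.
move=> up; apply: (@le_trans _ _ (p * excess m p J * F N)).
  by rewrite ler_wpM2r // hit_ge0 // !ltW.
apply: le_trans up _; rewrite lerB //.
by apply: ler_pM; rewrite ?subr_ge0 ?expR_ge0 // lerB.
Qed.

(** The scheme starts at [M >= m log m + m (m p)], where [m r^M <= exp (- m p)]. The square collects
    one factor [1 - exp (- m p)] from the excess and one from the coupons seen by time [M]. *)
Lemma hit_exp_lower (x : R) N : 0 <= x -> m%:R * ln (m%:R : R) + x / rate < N.+1%:R ->
  0 < a -> rate * (m%:R * (m%:R * p)) <= (1 - expR (- (m%:R * p))) ^+ 2 * a ->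
  ((1 - expR (- (m%:R * p))) ^+ 2 * a - rate * (m%:R * (m%:R * p))) *
    (1 - expR (- ((x - slack) / (a + rate)))) <= a * F N.
Proof.
move=> x_ge0 N_gt a_gt0 k_ge0.
set J := Num.truncn (m%:R * (m%:R * p) : R).
set M := (Num.truncn (m%:R * ln (m%:R : R) + m%:R * (m%:R * p) : R)).+1.
have J_gt : m%:R * (m%:R * p) <= J.+1%:R.
  by rewrite /J -natr1 ltW // truncn_gt // mulr_ge0 ?ltW.
have J_le : J%:R <= m%:R * (m%:R * p).
  by rewrite truncn_le mulr_ge0 ?ltW.
have sum_ge0 : 0 <= m%:R * ln (m%:R : R) + m%:R * (m%:R * p).
  by apply: addr_ge0; apply: mulr_ge0 => //; rewrite ltW.
have M_gt : m%:R * ln (m%:R : R) + m%:R * (m%:R * p) <= M%:R.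
  by rewrite /M -natr1 ltW // truncn_gt.
have M_le : M%:R <= m%:R * ln (m%:R : R) + m%:R * (m%:R * p) + 1.
  by rewrite /M -natr1 lerD2r truncn_le.
have e_le1 : expR (- (m%:R * p)) < 1 by rewrite expR_lt1 oppr_lt0.
have exc : (1 - expR (- (m%:R * p))) * a <= p * excess m p J.+1.
  apply: le_trans (excess_ge m_gt1 p01 J.+1); rewrite ler_pM2r // lerB //.
  by apply: ratio_exp_le; rewrite mulrC.
have exc_gt0 : 0 < p * excess m p J.+1.
  by apply: lt_le_trans exc; rewrite mulr_gt0 // subr_gt0.
have dx : rate * (x / rate) = x by rewrite mulrC divfK // gt_eqF.
have aF_ge0 k : 0 <= a * F k.
  by rewrite mulr_ge0 ?hit_ge0 // !ltW.
have [MN|NM] := leqP M N; last first.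
  (* If [N < M] then [x <= slack], so the left-hand side is nonpositive. *)
  apply: le_trans (aF_ge0 N); apply: mulr_ge0_le0; rewrite ?subr_ge0 ?subr_le0 //.
  rewrite -[leLHS]expR0 ler_expR oppr_ge0.
  apply: mulr_le0_ge0; last by rewrite invr_ge0 ltW // addr_gt0.
  rewrite subr_le0.
  rewrite -dx; apply: slack_ge.
  have : N.+1%:R <= M%:R :> R by rewrite ler_nat.
  by have := mR_gt1; move: N_gt; lra.
have := hit_lower m_gt1 p01 M (N - M) exc_gt0; rewrite subnKC // -/(F N) -/a.
apply: le_trans; set b := p * excess m p J.+1.
have b_le : b <= a := excess_le m_gt1 p01 J.+1.
have nE : (N - M)%:R = N%:R - M%:R :> R by rewrite natrB.
have dn : x - slack <= (N - M)%:R * rate.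
  rewrite lerBlDr -lerBlDl mulrC -{1}dx -mulrBr; apply: slack_ge.
  by have := mR_gt1; move: N_gt; rewrite nE -natr1; lra.
have pow : (1 + rate / b) ^- (N - M) <= expR (- ((x - slack) / (a + rate))).
  have br_gt0 : 0 < b + rate by rewrite addr_gt0.
  apply: (@le_trans _ _ (expR ((N - M)%:R * - (rate / (b + rate))))).
    rewrite expRM_natl -exprVn lerXn2r ?nnegrE ?expR_ge0 //.
      by rewrite invr_ge0 ltW // addr_gt0 ?divr_gt0.
    (* This form is bounded by [exp (- rate / (b + rate))]; then [b <= a] produces the denominator
       [a + rate]. *)
    have -> : (1 + rate / b)^-1 = 1 + - (rate / (b + rate)).
      by field; rewrite !gt_eqF.
    exact: expR_ge1Dx.
  rewrite ler_expR mulrN lerN2 mulrA ler_pdivrMr ?addr_gt0 // .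
  apply: le_trans dn _; rewrite -[leLHS]mulr1.
  have -> : (N - M)%:R * rate / (b + rate) * (a + rate) =
      (N - M)%:R * rate * ((a + rate) / (b + rate)).
    by field; rewrite gt_eqF.
  apply: ler_wpM2l; first by rewrite mulr_ge0 // ltW.
  by rewrite ler_pdivlMr // mul1r lerD2r.
have seen : m%:R * r ^+ M <= expR (- (m%:R * p)).
  rewrite -(@ler_pM2l _ m%:R^-1) ?invr_gt0 // mulKf ?gt_eqF //.
  apply: le_trans (@ratio_exp_le M (ln (m%:R : R) + m%:R * p) _) _.
    by rewrite mulrDl mulrC [_ * p * _]mulrC.
  by rewrite opprD expRD [expR (- ln _)]expRN lnK ?posrE.
set k' := (_ ^+ 2 * a - _); set c' := expR _ in pow *; set c := _ ^- _ in pow *.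
have c_le1 : c <= 1.
  by rewrite invf_le1 ?exprn_gt0 ?exprn_ege1 ?lerDl ?ltr_pwDl ?divr_ge0 ?ltW.
apply: (@le_trans _ _ (k' * (1 - c))).
  by rewrite ler_wpM2l ?subr_ge0 // lerB.
rewrite ler_wpM2r ?subr_ge0 // lerB //; last by rewrite ler_pM2l.
have e_ge0 : 0 <= 1 - expR (- (m%:R * p)) by rewrite subr_ge0 ltW.
rewrite expr2 mulrAC; apply: ler_pM => //; last by rewrite lerB.
by apply: mulr_ge0 => //; exact: ltW.
Qed.
End hit_bounds.

(** * Error terms of order [1 / (m p)] *)

Section error_bounds.
Variables (R : realType) (m : nat) (p : R).
Hypotheses (m_gt1 : (1 < m)%N) (p01 : 0 < p < 1) (mp_ge1 : 1 <= m%:R * p).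

Let l : R := m%:R * p.
Let l_gt0 : 0 < l. Proof. exact: lt_le_trans ltr01 mp_ge1. Qed.
Let i_gt0 : 0 < l^-1. Proof. by rewrite invr_gt0. Qed.
Let i_le1 : l^-1 <= 1. Proof. by rewrite invf_le1. Qed.

(** From [exp l >= l^3 / 3!]. The third order absorbs the factor [l (l + 2)] of the slack and still
    leaves [1 / l]. *)
Lemma expRN_le_cube : expR (- l) <= 6 * l^-1 ^+ 3.
Proof.
have := @expR_ge1Dxn R l 2 (ltW l_gt0); rewrite (_ : 3`! = 6)%N // => h.
rewrite expRN exprVn -[leLHS]mul1r ler_pdivrMr ?expR_gt0 // mulrAC.
rewrite ler_pdivlMr ?exprn_gt0 // mul1r -ler_pdivrMl // mulrC.
by apply: le_trans h; rewrite lerDr.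
Qed.

Lemma expRN_le_inv : expR (- l) <= 6 * l^-1.
Proof.
apply: le_trans expRN_le_cube _; rewrite ler_pM2l // exprS ger_pMr //.
by rewrite exprn_ile1 // ltW.
Qed.

Lemma expr1B_le_expRN : (1 - p) ^+ m <= expR (- l).
Proof.
rewrite /l -mulrN expRM_natl lerXn2r ?nnegrE ?expR_ge0 ?expR_ge1Dx //.
by case/andP: p01 => _ /ltW; rewrite subr_ge0.
Qed.

Let l0 : l != 0. Proof. by rewrite gt_eqF. Qed.

Lemma rate_slack_le : p * (1 - p) ^+ m * m%:R * (l + 2) <= 18 * l^-1.
Proof.
have -> : p * (1 - p) ^+ m * m%:R = l * (1 - p) ^+ m by rewrite /l; ring.
rewrite mulrAC; apply: le_trans (_ : l * (l + 2) * (6 * l^-1 ^+ 3) <= _).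
  rewrite ler_wpM2l ?(le_trans expr1B_le_expRN) ?expRN_le_cube //.
  by rewrite mulr_ge0 ?addr_ge0 // ltW.
have -> : l * (l + 2) * (6 * l^-1 ^+ 3) = (6 + 12 * l^-1) * l^-1 by field.
by rewrite ler_pM2r //; have := i_le1; lra.
Qed.

(** The constant 13 adds 1, from [1 / m <= 1 / l], to 12, from [(1 + l) * 6 / l^3 <= 12 / l]. *)
Lemma excess_limit_bounds :
  1 - 13 * l^-1 <= excess_limit m p <= 1 + 3 * l^-1.
Proof.
rewrite excess_limit_le // andbT; apply: le_trans (excess_limit_ge m_gt1 p01).
have mi : m%:R^-1 <= l^-1.
  rewrite lef_pV2 ?posrE ?ltr0n ?(ltnW m_gt1) // /l ger_pMr ?ltr0n ?(ltnW m_gt1) //.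
  by case/andP: p01 => _ /ltW.
have : (1 + m%:R * p) * (1 - p) ^+ m <= 12 * l^-1; last by lra.
apply: le_trans (_ : (1 + l) * (6 * l^-1 ^+ 3) <= _).
  rewrite ler_wpM2l ?(le_trans expr1B_le_expRN) ?expRN_le_cube //.
  by rewrite addr_ge0 // ltW.
have -> : (1 + l) * (6 * l^-1 ^+ 3) = 6 * (l^-1 * (l^-1 + 1)) * l^-1 by field.
have -> : (12 : R) = 6 * 2 by ring.
rewrite ler_pM2r // ler_pM2l //.
have : l^-1 * (l^-1 + 1) <= 1 * (1 + 1) by apply: ler_pM; rewrite ?addr_ge0 ?lerD // ltW.
by rewrite mul1r.
Qed.

End error_bounds.

(** * Limit of the hitting probabilities *)

Section limit.
Variables (R : realType) (p : nat -> R) (x : R).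
Hypotheses (p01 : forall m, (0 < m)%N -> 0 <= p m < 1)
  (mp_oo : m%:R * p m @[m --> \oo] --> +oo) (x_ge0 : 0 <= x).

Let l m : R := m%:R * p m.
Let rate m : R := p m * (1 - p m) ^+ m.
Let slack m : R := rate m * m%:R * (l m + 2).
Let a m : R := excess_limit m (p m).
(** When [rate m > 0], the last integer time with [rate m * (N - m log m) <= x]. *)
Let N m : nat := Num.truncn (m%:R * ln (m%:R : R) + x / rate m).

Let good : \forall m \near \oo, [/\ (1 < m)%N, 0 < p m < 1 & 1 <= l m].
Proof.
have le1 := (cvgryPge _).1 mp_oo 1.
near=> m.
have m_gt1 : (1 < m)%N by near: m; exact: nbhs_infty_gt.
have l1 : 1 <= l m by near: m; exact: le1.
split => //; have /andP[p0 ->] := p01 (ltnW m_gt1).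
rewrite andbT lt0r p0 andbT; apply/eqP => pm.
by move: l1; rewrite /l pm mulr0 ler10.
Unshelve. all: by end_near. Qed.

Let inv_cvg : (l m)^-1 @[m --> \oo] --> 0.
Proof.
apply/gtr0_cvgV0 => //; near=> m.
have [_ _] : [/\ (1 < m)%N, 0 < p m < 1 & 1 <= l m] by near: m; exact: good.
exact: lt_le_trans ltr01.
Unshelve. all: by end_near. Qed.

Let squeeze0 (f : nat -> R) c :
  (\forall m \near \oo, 0 <= f m <= c * (l m)^-1) -> f m @[m --> \oo] --> 0.
Proof.
move=> h; apply: (squeeze_cvgr h); first exact: cvg_cst.
by rewrite -(mulr0 c); apply: cvgMl_tmp.
Qed.

Let E_cvg : expR (- l m) @[m --> \oo] --> 0.
Proof.
apply: (@squeeze0 _ 6); near=> m; rewrite expR_ge0 /=.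
have [m1 pm l1] : [/\ (1 < m)%N, 0 < p m < 1 & 1 <= l m] by near: m; exact: good.
exact: expRN_le_inv.
Unshelve. all: by end_near. Qed.

Let a_cvg : a m @[m --> \oo] --> (1 : R).
Proof.
apply: (@squeeze_cvgr _ _ _ _ (fun m => 1 - 13 * (l m)^-1) (fun m => 1 + 3 * (l m)^-1)).
- near=> m.
  have [m1 pm l1] : [/\ (1 < m)%N, 0 < p m < 1 & 1 <= l m] by near: m; exact: good.
  exact: excess_limit_bounds.
- rewrite -[X in _ --> X]subr0 -[X in _ - X](mulr0 13).
  by apply: cvgB; [exact: cvg_cst|exact: cvgMl_tmp].
- rewrite -[X in _ --> X]addr0 -[X in _ + X](mulr0 3).
  by apply: cvgD; [exact: cvg_cst|exact: cvgMl_tmp].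
Unshelve. all: by end_near. Qed.

(** The slack is at most [18 / l], and it dominates [rate], [rate * m] and [rate * m * l], the other
    errors in the bounds. *)
Let squeeze_slack (f : nat -> R) :
  (forall m, (1 < m)%N -> 0 < p m < 1 -> 1 <= l m -> 0 <= f m <= slack m) ->
  f m @[m --> \oo] --> 0.
Proof.
move=> h; apply: (@squeeze0 _ 18); near=> m.
have [m1 pm l1] : [/\ (1 < m)%N, 0 < p m < 1 & 1 <= l m] by near: m; exact: good.
have /andP[-> h2] := h m m1 pm l1.
exact: le_trans h2 (rate_slack_le pm l1).
Unshelve. all: by end_near. Qed.

Let rate_ge0 m : (1 < m)%N -> 0 <= rate m.
Proof.
move=> /ltnW/p01/andP[p0 p1].
by rewrite mulr_ge0 // exprn_ge0 // subr_ge0 ltW.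
Qed.

Let slack_cvg : slack m @[m --> \oo] --> 0.
Proof.
apply: squeeze_slack => m m1 pm l1; rewrite lexx andbT.
apply: mulr_ge0; first exact: mulr_ge0 (rate_ge0 m1) (ler0n _ _).
by apply: addr_ge0 => //; exact: le_trans ler01 l1.
Qed.

Let rate_cvg : rate m @[m --> \oo] --> 0.
Proof.
apply: squeeze_slack => m m1 pm l1.
rewrite rate_ge0 //= /slack -mulrA ler_peMr ?rate_ge0 //.
apply: mulr_ege1; first by rewrite ler1n ltnW.
by apply: le_trans l1 _; rewrite lerDl.
Qed.

Let ratem_cvg : rate m * m%:R @[m --> \oo] --> 0.
Proof.
apply: squeeze_slack => m m1 pm l1.
have rm : 0 <= rate m * m%:R := mulr_ge0 (rate_ge0 m1) (ler0n _ _).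
rewrite rm /= /slack ler_peMr //.
by apply: le_trans l1 _; rewrite lerDl.
Qed.

Let rateml_cvg : rate m * (m%:R * l m) @[m --> \oo] --> 0.
Proof.
apply: squeeze_slack => m m1 pm l1; have l0 := le_trans ler01 l1.
apply/andP; split; first by apply: mulr_ge0; [exact: rate_ge0|exact: mulr_ge0].
rewrite /slack mulrA.
rewrite ler_wpM2l //; last by rewrite lerDl.
exact: mulr_ge0 (rate_ge0 m1) (ler0n _ _).
Qed.

Let expR_cvg (f g : nat -> R) : f m @[m --> \oo] --> x -> g m @[m --> \oo] --> (1 : R) ->
  expR (- (f m / g m)) @[m --> \oo] --> expR (- x).
Proof.
move=> fx g1; apply: continuous_cvg; first exact: continuous_expR.
apply: cvgN; rewrite -[X in _ --> X]mulr1; apply: cvgM => //.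
by rewrite -invr1; apply: cvgV => //; exact: oner_neq0.
Qed.

(** The upper and lower exponential bounds, divided by their coefficients of [F], both tend to
    [1 - exp (- x)]. *)
Lemma hit_cvg :
  hit (p m) (N m) (finset.set0 : {set 'I_m}) @[m --> \oo] --> (1 - expR (- x) : R).
Proof.
have xD : x + slack m @[m --> \oo] --> x.
  by rewrite -[X in _ --> X]addr0; apply: cvgD => //; exact: cvg_cst.
have xB : x - slack m @[m --> \oo] --> x.
  by rewrite -[X in _ --> X]subr0; apply: cvgB => //; exact: cvg_cst.
have aD : a m + rate m @[m --> \oo] --> (1 : R).
  by rewrite -[X in _ --> X]addr0; apply: cvgD.
have E1 : 1 - expR (- l m) @[m --> \oo] --> (1 : R).
  by rewrite -[X in _ --> X]subr0; apply: cvgB => //; exact: cvg_cst.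
have a1E : (1 - expR (- l m)) * a m @[m --> \oo] --> (1 : R).
  by rewrite -[X in _ --> X]mulr1; apply: cvgM.
have k1 : (1 - expR (- l m)) ^+ 2 * a m - rate m * (m%:R * l m) @[m --> \oo] --> (1 : R).
  rewrite -[X in _ --> X]subr0; apply: cvgB => //.
  rewrite -[X in _ --> X]mulr1; apply: cvgM => //.
  by rewrite -[X in _ --> X]mulr1; exact: cvgM.
have adm : a m - rate m * m%:R @[m --> \oo] --> (1 : R).
  by rewrite -[X in _ --> X]subr0; apply: cvgB.
pose up m := (a m - (a m - rate m * m%:R) * expR (- ((x + slack m) / a m)))
   / ((1 - expR (- l m)) * a m).
pose lo m := ((1 - expR (- l m)) ^+ 2 * a m - rate m * (m%:R * l m)) *
    (1 - expR (- ((x - slack m) / (a m + rate m)))) / a m.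
apply: (@squeeze_cvgr _ _ _ _ lo up); last 2 first.
- rewrite -[X in _ --> X]divr1; apply: cvgM; last exact: cvgV.
  rewrite -[X in _ --> X]mul1r; apply: cvgM => //.
  by apply: cvgB; [exact: cvg_cst|exact: expR_cvg].
- rewrite -[X in _ --> X]divr1; apply: cvgM; last exact: cvgV.
  apply: cvgB => //; rewrite -[X in _ --> X]mul1r; apply: cvgM; last exact: expR_cvg.
  exact: adm.
near=> m.
have [m1 pm l1] : [/\ (1 < m)%N, 0 < p m < 1 & 1 <= l m] by near: m; exact: good.
have a_gt0 : 0 < a m by near: m; exact: (cvgr_gt _ a_cvg).
have da : rate m * m%:R <= a m.
  rewrite -subr_ge0; near: m; exact: (cvgr_ge _ adm).
have k_ge0 : rate m * (m%:R * l m) <= (1 - expR (- l m)) ^+ 2 * a m.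
  rewrite -subr_ge0; near: m; exact: (cvgr_ge _ k1).
have E_gt0 : 0 < (1 - expR (- l m)) * a m by near: m; exact: (cvgr_gt _ a1E).
have rate_gt0 : 0 < rate m.
  by case/andP: pm => p0 p1; rewrite mulr_gt0 // exprn_gt0 // subr_gt0.
have ln_ge0 : 0 <= ln (m%:R : R) by rewrite ln_ge0 // ler1n ltnW.
have T_ge0 : 0 <= m%:R * ln (m%:R : R) + x / rate m.
  by rewrite addr_ge0 ?mulr_ge0 ?invr_ge0 // ltW.
apply/andP; split.
- rewrite /lo ler_pdivrMr // [leRHS]mulrC; apply: hit_exp_lower => //.
  by have /andP[] := truncn_itv T_ge0.
- rewrite /up ler_pdivlMr // [leLHS]mulrC; apply: hit_exp_upper => //.
    by rewrite truncn_le.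
  apply: le_truncn; rewrite -[leLHS]addr0; apply: lerD; last by rewrite divr_ge0 // ltW.
  by rewrite ler_wpM2r // gerBl.
Unshelve. all: by end_near. Qed.
End limit.

(** * Draws as letters of finite words *)

Section letters.
Variables (R : realFieldType) (m : nat) (p : R).

(** The boolean records whether the copy drawn is good. *)
Definition letter : finType := ('I_m * bool)%type.

(* The full state is absorbing, so that [hit] is read off the final state. *)
Definition step (S : {set 'I_m}) (a : letter) : {set 'I_m} :=
  if full S then S else if a.2 then (a.1 |: S)%SET else (S :\ a.1)%SET.

(* Words list the most recent letter first. *)
Definition state (s : seq letter) : {set 'I_m} :=
  foldr (fun a S => step S a) finset.set0 s.

Definition letter_weight (a : letter) : R := m%:R^-1 * (if a.2 then 1 - p else p).

Lemma transition_letter f S :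
  transition p f S =
  \sum_(a : letter) letter_weight a * f (if a.2 then (a.1 |: S)%SET else (S :\ a.1)%SET).
Proof.
rewrite /transition mulr_sumr.
rewrite (eq_bigr (fun i : 'I_m => \sum_(b : bool) letter_weight (i, b) *
    f (if b then (i |: S)%SET else (S :\ i)%SET))) => [|i _]; last first.
  by rewrite big_bool /letter_weight /=; ring.
by rewrite pair_bigA /=; apply: eq_bigr => -[].
Qed.

Lemma sum_letter_weight : (0 < m)%N -> \sum_(a : letter) letter_weight a = 1.
Proof.
move=> m_gt0; rewrite -[RHS](transition_cst p 1 (finset.set0 : {set 'I_m}) m_gt0).
by rewrite transition_letter; apply: eq_bigr => a _; rewrite mulr1.
Qed.

(** At the full set [step] stays put and [hit] is 1, so the backward equation holds from every set,
    as [prob_ge_backward] asks. *)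
Lemma hit_letter N S : (0 < m)%N ->
  hit p N.+1 S = \sum_(a : letter) letter_weight a * hit p N (step S a).
Proof.
move=> m_gt0; rewrite hitS; case: ifP => fS; last first.
  by rewrite transition_letter; apply: eq_bigr => a _; rewrite /step fS.
rewrite -{1}(sum_letter_weight m_gt0); apply: eq_bigr => a _.
by rewrite /step fS hit_full // mulr1.
Qed.

End letters.

(** * Trajectories and cylinder events *)

Section trajectories.
Context {d} {T : measurableType d} {R : realType}.
Variables (m : nat) (p : R) (C : nat -> T -> nat) (U : nat -> T -> R).

Definition good_coupon (i n : nat) (w : T) : Prop :=
  (0 < last_seen C i n w)%N /\ U (last_seen C i n w) w <= 1 - p.

Lemma last_seenS i n w :
  last_seen C i n.+1 w = if C n.+1 w == i then n.+1 else last_seen C i n w.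
Proof.
rewrite /last_seen big_mkcond big_nat_recr //= -big_mkcond /=.
case: ifP => _; last exact: maxn0.
apply/maxn_idPr/bigmax_leqP_seq => k.
by rewrite mem_index_iota => /andP[_ kn] _; exact: ltnW.
Qed.

Lemma good_coupon0 i w : ~ good_coupon i 0 w.
Proof. by case; rewrite /last_seen big_geq. Qed.

Lemma good_couponS i n w : good_coupon i n.+1 w <->
  if C n.+1 w == i then U n.+1 w <= 1 - p : Prop else good_coupon i n w.
Proof. by rewrite /good_coupon last_seenS; case: ifP => //; split=> // -[]. Qed.

(** Ordinals start at 0 and coupons at 1, hence the shift [i.+1]. *)
Lemma complete_atE n w :
  complete_at m p C U n w <-> forall i : 'I_m, good_coupon i.+1 n w.
Proof.
split=> [h i|h [|i] // im]; first by apply: h; rewrite /= ltn_ord.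
exact: h (Ordinal im).
Qed.

(** The event that the first [size s] draws spell [s]; the head of [s] is the draw made at time
    [size s]. *)
Fixpoint cylinder (s : seq (letter m)) : set T :=
  if s is a :: s' then
    [set w | [/\ cylinder s' w, C (size s) w = a.1.+1 &
                (U (size s) w <= 1 - p) = a.2]]
  else setT.

Definition completed_by N : set T :=
  [set w | exists n, (0 < n <= N)%N /\ complete_at m p C U n w].

(** Until completion the state is exactly the set of coupons whose last copy is good; absorption at
    the full set then remembers that completion has occurred. *)
Lemma cylinder_state s w : (0 < m)%N -> cylinder s w ->
  if full (state s) then completed_by (size s) w
  else (forall i : 'I_m, i \in state s <-> good_coupon i.+1 (size s) w) /\
       ~ completed_by (size s) w.
Proof.
move=> m_gt0; elim: s => [_|a s IH /= [/IH {}IH Ca Ua]].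
  case: ifP => [/eqP /setP /(_ (Ordinal m_gt0))|_]; first by rewrite !inE.
  split=> [i|[n]]; last by case: n => [|n] [].
  by rewrite inE; split=> // /good_coupon0.
have cS : completed_by (size s).+1 w <->
    completed_by (size s) w \/ complete_at m p C U (size s).+1 w.
  split=> [[n [/andP[n0]]]|[[n [/andP[n0 ns] cn]]|cn]].
  - rewrite leq_eqVlt => /orP[/eqP ->|ns] cn; [by right|left].
    by exists n; rewrite n0.
  - by exists n; rewrite n0 ltnW.
  - by exists (size s).+1; rewrite leqnn.
have [fs|nfs] := boolP (full (state s)).
  by rewrite /step fs fs; apply/cS; left; rewrite fs in IH.
rewrite (negbTE nfs) in IH; case: IH => st_s nc.
have st (i : 'I_m) : i \in step (state s) a <-> good_coupon i.+1 (size s).+1 w.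
  rewrite good_couponS Ca eqSS /step (negbTE nfs) Ua.
  have -> : (val a.1 == val i) = (i == a.1) by rewrite eq_sym.
  by case: a.2; rewrite !inE; case: (i == a.1) => //=; exact: st_s.
have cf : complete_at m p C U (size s).+1 w <-> full (step (state s) a).
  rewrite complete_atE; split=> [h|/eqP h i]; last by apply/st; rewrite h inE.
  by apply/eqP/setP => i; rewrite inE; apply/st.
case: ifPn => fa; first by apply/cS; right; apply/cf.
by split=> // /cS[//|/cf]; rewrite (negbTE fa).
Qed.

(** Draw-by-draw form, suited to independence: position [k] of the word is time [size s - k]. *)
Lemma cylinderE a0 s w : cylinder s w <->
  forall k, (k < size s)%N -> C (size s - k) w = (nth a0 s k).1.+1 /\
    (U (size s - k) w <= 1 - p) = (nth a0 s k).2.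
Proof.
elim: s => [|a s IH] /=; first by split.
split=> [[/IH h Ca Ua] [|k] ks|h]; first by rewrite subn0.
  by rewrite subSS; exact: h.
split; last 2 first.
- by have [] := h 0%N isT; rewrite subn0.
- by have [] := h 0%N isT; rewrite subn0.
by apply/IH => k ks; have := h k.+1 ks; rewrite subSS.
Qed.

Lemma cylinder_disjoint s a b w : cylinder (a :: s) w -> cylinder (b :: s) w -> a = b.
Proof.
move=> /= [_ Ca Ua] [_ Cb Ub]; case: a Ca Ua => a1 a2; case: b Cb Ub => b1 b2 /=.
by move=> -> <- [] /val_inj -> <-.
Qed.

End trajectories.

(** * Law of a finite sequence of draws *)

Lemma uniform_prob_itvNyc (R : realType) (b : R) : 0 <= b <= 1 ->
  uniform_prob (@ltr01 R) `]-oo, b] = b%:E.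
Proof.
case/andP=> b0 b1; rewrite /uniform_prob integral_uniform_pdf.
rewrite (_ : `]-oo, b] `&` `[0, 1] = `[0, b]%classic); last first.
  apply/seteqP; split=> x /=; rewrite !in_itv /=.
    by case=> xb /andP[-> _].
  by case/andP=> -> xb; rewrite xb (le_trans xb b1).
rewrite (eq_integral (fun=> 1%:E)); last first.
  move=> x /set_mem; rewrite /= in_itv /= => /andP[x0 xb].
  by rewrite /uniform_pdf x0 (le_trans xb b1) subr0 invr1.
rewrite integral_cst //= mul1e lebesgue_measure_itv /= lte_fin.
case: ltgtP b0 => // [b0 _|<- //]; by rewrite oppr0 adde0.
Qed.

Section coupon_probability.
Context {d} {T : measurableType d} {R : realType} (P : probability T R).
Variables (m : nat) (p : R) (C : nat -> {RV P >-> nat}) (U : nat -> {RV P >-> R}).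
Hypotheses (m_gt0 : (0 < m)%N) (p01 : 0 <= p < 1) (model : coupon_model m C U).

(** The conditions of a cylinder, indexed as in the independence hypothesis of [coupon_model]. *)
Let coupon_event (a0 : letter m) (s : seq (letter m)) (j : nat + nat) : set T :=
  match j with
  | inl n => [set w | (U n w <= 1 - p) = (nth a0 s (size s - n)).2]
  | inr n => [set w | C n w = (nth a0 s (size s - n)).1.+1]
  end.

Let pU n : (0 < n)%N -> P [set w | U n w <= 1 - p] = (1 - p)%:E.
Proof.
case: model => _ hU _ n0; have /andP[p0 p1] := p01.
have := hU n n0 `]-oo, 1 - p]%classic (measurable_itv _).
by rewrite uniform_prob_itvNyc ?subr_ge0 ?gerBl ?p0 ?(ltW p1) // => <-.
Qed.

Lemma measurable_good_draw n : measurable [set w | U n w <= 1 - p].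
Proof.
rewrite -[X in measurable X]setTI.
exact: (measurable_funP (U n) measurableT `]-oo, 1 - p]%classic).
Qed.

Lemma measurable_draw n i : measurable [set w | C n w = i].
Proof.
by rewrite -[X in measurable X]setTI; exact: (measurable_funP (C n) measurableT [set i]).
Qed.

Let prob_event a0 s k : (k < size s)%N ->
  P (coupon_event a0 s (inl (size s - k)%N)) =
    (if (nth a0 s k).2 then 1 - p else p)%:E /\
  P (coupon_event a0 s (inr (size s - k)%N)) = (m%:R^-1)%:E.
Proof.
move=> ks; have n0 : (0 < size s - k)%N by rewrite subn_gt0.
split; rewrite /coupon_event subKn ?(ltnW ks) //; last first.
  by case: model => + _ _ => /(_ _ (nth a0 s k).1.+1 n0); apply; rewrite /= ltn_ord.
case: (nth a0 s k).2.
  rewrite -(pU n0); congr (P _).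
rewrite (_ : [set w | _] = ~` [set w | U (size s - k)%N w <= 1 - p]).
  by rewrite probability_setC ?pU // -?EFinB ?subKr //; exact: measurable_good_draw.
by apply/seteqP; split=> w /=; [move=> -> |move=> /negP/negbTE].
Qed.

Lemma measurable_cylinder (s : seq (letter m)) : measurable (cylinder p C U s).
Proof.
elim: s => [|a s IH] /=; first exact: measurableT.
rewrite (_ : [set w | _] = cylinder p C U s `&` [set w | C (size s).+1 w = a.1.+1] `&`
  [set w | (U (size s).+1 w <= 1 - p) = a.2]); last first.
  by apply/seteqP; split=> w /= [] // [].
apply: measurableI; first by apply: measurableI => //; exact: measurable_draw.
case: a.2; first exact: measurable_good_draw.
rewrite (_ : [set w | _] = ~` [set w | U (size s).+1 w <= 1 - p]).
  by apply: measurableC; exact: measurable_good_draw.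
by apply/seteqP; split=> w /=; [move=> -> |move=> /negP/negbTE].
Qed.

(** A cylinder is an intersection of [2 * size s] independent events, two for each draw. *)
Lemma prob_cylinder (s : seq (letter m)) :
  P (cylinder p C U s) = (\prod_(a <- s) letter_weight p a)%:E.
Proof.
pose a0 : letter m := (Ordinal m_gt0, true).
(* The times [size s, ..., 1], in the order of the letters. *)
pose L := [seq (size s - k)%N | k <- iota 0 (size s)].
have uL : uniq L.
  rewrite map_inj_in_uniq ?iota_uniq // => i j; rewrite !mem_iota !add0n /= => i_s j_s e.
  by rewrite -(subKn (ltnW i_s)) e subKn // ltnW.
pose js : seq (nat + nat) := [seq inl n | n <- L] ++ [seq inr n | n <- L].
have ujs : uniq js.
  have inl_inj : injective (@inl nat nat) by move=> ? ? [].
  have inr_inj : injective (@inr nat nat) by move=> ? ? [].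
  rewrite cat_uniq (map_inj_uniq inl_inj) (map_inj_uniq inr_inj) uL andbT /=.
  by apply/hasPn => _ /mapP[n _ ->]; apply/negP => /mapP[].
have mem_js j : j \in js -> exists2 k, (k < size s)%N &
    j = inl (size s - k)%N \/ j = inr (size s - k)%N.
  rewrite mem_cat => /orP[] /mapP[_ /mapP[k + ->] ->]; rewrite mem_iota add0n => /= ks.
    by exists k => //; left.
  by exists k => //; right.
have js_fset j : j \in seq_fset tt js <-> j \in js by rewrite seq_fsetE.
case: model => _ _ ind; have := ind (seq_fset tt js) (coupon_event a0 s).
rewrite (perm_big _ (seq_fset_perm tt js)) undup_id // => h.
transitivity (P (\bigcap_(j in [set` seq_fset tt js]) coupon_event a0 s j)).
  congr (P _); apply/seteqP; split=> w.
    move=> /(cylinderE p C U a0) cw j jJ; have : j \in js by apply: (js_fset _).1.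
    by case/mem_js => k ks [] ->; rewrite /coupon_event /= subKn ?(ltnW ks) //;
      case: (cw k ks).
  move=> cw; apply/(cylinderE p C U a0) => k ks.
  have kL : (size s - k)%N \in L by apply/mapP; exists k; rewrite // mem_iota add0n.
  have c1 : coupon_event a0 s (inl (size s - k)%N) w.
    by apply: cw; apply: (js_fset _).2; rewrite mem_cat map_f.
  have c2 : coupon_event a0 s (inr (size s - k)%N) w.
    by apply: cw; apply: (js_fset _).2; rewrite mem_cat (map_f _ kL) orbT.
  by rewrite /coupon_event /= subKn ?(ltnW ks) // in c1 c2.
rewrite {}h.
- rewrite /js big_cat /= !big_map -big_split /= (big_nth a0) -prodEFin /index_iota subn0.
  apply: eq_big_seq => k; rewrite mem_iota add0n => /= ks.
  have [-> ->] := prob_event a0 ks.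
  by rewrite -EFinM mulrC.
- move=> j jJ; have : j \in js by apply: (js_fset _).1.
  move=> /mem_js[k ks []] ->; by rewrite /= subn_gt0.
- move=> j; rewrite seq_fsetE => /mem_js[k ks []] ->;
    rewrite /sigma_rv /preimage_set_system /=.
    exists [set y | (y <= 1 - p) = (nth a0 s (size s - (size s - k))).2] => //;
      last by rewrite setTI.
    case: (nth _ _ _).2.
      exact: (measurable_itv `]-oo, 1 - p]).
    rewrite (_ : [set y | _] = `]1 - p, +oo[%classic); first exact: measurable_itv.
    apply/seteqP; split=> y /=; rewrite in_itv /= andbT ltNge;
      by [move=> -> |move=> /negbTE].
  by exists [set (nth a0 s (size s - (size s - k))).1.+1] => //; rewrite setTI.
Qed.

End coupon_probability.

(** * Law of the completion time *)

Section completion_probability.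
Context {d} {T : measurableType d} {R : realType} (P : probability T R).
Variables (m : nat) (p : R) (C : nat -> {RV P >-> nat}) (U : nat -> {RV P >-> R}).

Lemma measurable_good_coupon i n : measurable [set w | good_coupon p C U i n w].
Proof.
elim: n => [|n IH].
  rewrite (_ : [set w | _] = set0); first exact: measurable0.
  by apply/seteqP; split=> w //= /good_coupon0.
rewrite (_ : [set w | _] = ([set w | C n.+1 w = i] `&` [set w | U n.+1 w <= 1 - p]) `|`
    (~` [set w | C n.+1 w = i] `&` [set w | good_coupon p C U i n w])).
  apply: measurableU; apply: measurableI => //.
  - exact: measurable_draw.
  - exact: measurable_good_draw.
  - by apply: measurableC; exact: measurable_draw.
apply/seteqP; split=> w /=.
  by move=> /good_couponS; case: eqP => e; [left|right].
by move=> h; apply/good_couponS; case: eqP => e; case: h => -[].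
Qed.

Lemma measurable_complete_at n : measurable [set w | complete_at m p C U n w].
Proof.
rewrite (_ : [set w | _] = \bigcap_(i in [set i | 1 <= i <= m]%N)
    [set w | good_coupon p C U i n w]) //.
by apply: bigcap_measurableType => i _; exact: measurable_good_coupon.
Qed.

Lemma measurable_completed_by N : measurable (completed_by m p C U N).
Proof.
rewrite (_ : completed_by _ _ _ _ _ = \bigcup_(n in [set n | 0 < n <= N]%N)
    [set w | complete_at m p C U n w]).
  by apply: bigcup_measurable => n _; exact: measurable_complete_at.
by apply/seteqP; split=> w [n]; [case|]; exists n.
Qed.

Lemma measurable_clumsy_time :
  measurable_fun [set: T] (clumsy_time m p C U).
Proof.
(* With the default value [+oo] off the event, [T] becomes a countable infimum of measurable
   functions. *)
pose f n w : \bar R := if `[< (0 < n)%N /\ complete_at m p C U n w >]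
  then n%:R%:E else +oo%E.
have -> : clumsy_time m p C U = (fun w => einfs (f ^~ w) 0%N).
  apply/funext => w; apply/eqP; rewrite eq_le; apply/andP; split.
    apply/ereal_infP => _ [n _ <-]; rewrite /f; case: asboolP => h; last exact: leey.
    by apply: ereal_inf_lbound; exists n.
  apply/ereal_infP => _ [n h <-]; apply: ereal_inf_lbound; exists n => //.
  by rewrite /f asboolT.
apply: measurable_fun_einfs => n; apply: measurable_fun_ifT => //.
apply: (measurable_fun_bool true); rewrite setTI.
rewrite (_ : _ @^-1` _ = if (0 < n)%N then [set w | complete_at m p C U n w] else set0).
  by case: ifP => // _; exact: measurable_complete_at.
apply/seteqP; split=> w /= ; last by case: ifP => // n0 cn; apply/asboolP.
by move=> /asboolP[->].
Qed.

Hypotheses (m_gt0 : (0 < m)%N) (p01 : 0 <= p < 1) (model : coupon_model m C U).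

(* Only superadditivity over the letters is used: applied to a set and to its
   complement, with weights adding up to 1, it yields equalities. *)
Lemma prob_ge_backward (h : nat -> {set 'I_m} -> R) (B : set T) (N : nat) :
  measurable B ->
  (forall j S, h j.+1 S = \sum_(a : letter m) letter_weight p a * h j (step S a)) ->
  (forall s : seq (letter m), size s = N ->
    (((\prod_(a <- s) letter_weight p a) * h 0 (state s))%R%:E
      <= P (cylinder p C U s `&` B))%E) ->
  forall j (s : seq (letter m)), (size s + j = N)%N ->
    (((\prod_(a <- s) letter_weight p a) * h j (state s))%R%:E
      <= P (cylinder p C U s `&` B))%E.
Proof.
move=> mB hS h0; elim=> [|j IH] s; first by rewrite addn0; exact: h0.
move=> sN; rewrite hS.
pose E (a : letter m) := cylinder p C U (a :: s) `&` B.
have mE a : measurable (E a) by apply: measurableI => //; exact: measurable_cylinder.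
apply: (@le_trans _ _ (P (\bigcup_(a in [set` index_enum (letter m)]) E a))); last first.
  apply: le_measure; rewrite ?in_setE.
  - by apply: fin_bigcup_measurable => [|a _]; [exact: finite_finset|exact: mE].
  - by apply: measurableI => //; exact: measurable_cylinder.
  - by move=> w [a _ [[cw _ _] Bw]].
rewrite measure_fin_bigcup //; last first.
  by move=> a b _ _ [w [[ca _] [cb _]]]; exact: cylinder_disjoint ca cb.
rewrite -fsbig_seq ?index_enum_uniq // mulr_sumr -sumEFin; apply: lee_sum => a _.
have := IH (a :: s); rewrite /= big_cons addSnnS => /(_ sN).
by apply: le_trans; rewrite mulrCA mulrA.
Qed.

(** [prob_ge_backward] is applied to the event with [hit] and to its complement with [1 - hit],
    which obeys the same recursion. *)
Lemma prob_completed_by N :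
  P (completed_by m p C U N) = (hit p N (finset.set0 : {set 'I_m}))%:E.
Proof.
have mA := measurable_completed_by N.
have lo : ((hit p N (finset.set0 : {set 'I_m}))%:E <= P (completed_by m p C U N))%E.
  have := @prob_ge_backward (fun j => hit p j) _ N mA _ _ N [::].
  rewrite big_nil mul1r setTI; apply=> //.
    by move=> j S; exact: hit_letter.
  move=> s sN; rewrite hit0; have [fs|_] := boolP (full _); last by rewrite mulr0.
  rewrite mulr1 -(prob_cylinder m_gt0 p01 model) le_measure ?in_setE //.
  - exact: measurable_cylinder.
  - by apply: measurableI => //; exact: measurable_cylinder.
  - by move=> w cw; split=> //; have := cylinder_state m_gt0 cw; rewrite fs sN.
have up :
    ((1 - hit p N (finset.set0 : {set 'I_m}))%:E <= P (~` completed_by m p C U N))%E.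
  have := @prob_ge_backward (fun j S => 1 - hit p j S) _ N (measurableC mA) _ _ N [::].
  rewrite big_nil mul1r setTI; apply=> //.
    move=> j S; rewrite hit_letter // -{1}(sum_letter_weight p m_gt0) -sumrB.
    by apply: eq_bigr => a _; rewrite mulrBr mulr1.
  move=> s sN; rewrite hit0; have [_|fs] := boolP (full _).
    by rewrite subrr mulr0.
  rewrite subr0 mulr1 -(prob_cylinder m_gt0 p01 model) le_measure ?in_setE //.
  - exact: measurable_cylinder.
  - by apply: measurableI => //; [exact: measurable_cylinder|exact: measurableC].
  - move=> w cw; split=> //; have := cylinder_state m_gt0 cw.
    by rewrite (negbTE fs) sN => -[].
apply/eqP; rewrite eq_le lo andbT; move: up.
rewrite probability_setC // -(fineK (fin_num_measure P _ mA)) -EFinB !lee_fin.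
by rewrite lerD2l lerN2.
Qed.

Lemma clumsy_time_le (y : R) :
  P [set w | (clumsy_time m p C U w <= y%:E)%E] =
  if 0 <= y then (hit p (Num.truncn y) (finset.set0 : {set 'I_m}))%:E else 0%E.
Proof.
case: ifPn => y0; last first.
  rewrite (_ : [set w | _] = set0) ?measure0 //.
  apply/seteqP; split=> w //= Ty; move: y0; rewrite -lee_fin => /negP; apply.
  apply: le_trans Ty; apply/ereal_infP => _ [n _ <-].
  by rewrite lee_fin.
rewrite -prob_completed_by; congr (P _); apply/seteqP; split=> w /=.
  (* The strict bound by [truncn y + 1] yields a completion time below it, hence at most
     [truncn y]. *)
  move=> Ty; have /ereal_inf_lt[_ [n [n0 cn] <-]] :
      (clumsy_time m p C U w < (Num.truncn y).+1%:R%:E)%E.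
    by apply: le_lt_trans Ty _; rewrite lte_fin; have /andP[] := truncn_itv y0.
  by rewrite lte_fin ltr_nat ltnS => nN; exists n; rewrite n0.
move=> [n [/andP[n0 nN] cn]]; apply: (@le_trans _ _ n%:R%:E).
  by apply: ereal_inf_lbound; exists n.
by rewrite lee_fin -truncn_ge_nat.
Qed.

End completion_probability.

(** * The exponential limit law and convergence to it *)

Lemma exponential_law_itvNyc (R : realType) (x : R) :
  exponential_law (@ltr01 R) `]-oo, x]%classic =
  (if 0 <= x then 1 - expR (- x) else 0)%:E.
Proof.
have neg (A : set R) : A `<=` `]-oo, 0[%classic -> exponential_prob 1 A = 0%E.
  move=> A0; rewrite /exponential_prob integral0_eq // => y /A0 /=.
  rewrite in_itv /= => y0.
  by rewrite lt0_exponential_pdf.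
case: ifPn => [|/negbTE x0]; last first.
  apply: neg => y /=; rewrite !in_itv /= => /le_lt_trans; apply.
  by rewrite ltNge x0.
rewrite le_eqVlt => /orP[/eqP <-|x0].
  rewrite oppr0 expR0 subrr.
  rewrite (_ : `]-oo, 0]%classic = `]-oo, 0[%classic `|` [set (0:R)]); last first.
    apply/seteqP; split=> y /=; rewrite !in_itv /= le_eqVlt.
      by case/orP => [/eqP|]; [right|left].
    by case=> [->|->]; rewrite ?orbT // eqxx.
  rewrite measureU //=.
    rewrite /exponential_law /= (neg _ (@subset_refl _ _)) add0e.
    exact: integral_set1.
  by apply/seteqP; split=> y //= []; rewrite in_itv /= => y0 ye; rewrite ye ltxx in y0.
rewrite (_ : `]-oo, x]%classic = `]-oo, 0[%classic `|` `[0, x]%classic); last first.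
  apply/seteqP; split=> y /=; rewrite !in_itv /=.
    by move=> yx; case: ltP => y0; [left|right].
  by case=> [y0|/andP[]//]; exact: le_trans (ltW y0) (ltW x0).
rewrite measureU //=.
  rewrite /exponential_law /= (neg _ (@subset_refl _ _)) add0e.
  by rewrite exponential_prob_itv0c // mulN1r.
apply/seteqP; split=> y //= []; rewrite !in_itv /= => y0 /andP[y1].
by rewrite ltNge y1 in y0.
Qed.

Lemma scaled_shift_le (R : realType) (c k x : R) (t : \bar R) : 0 < c ->
  ((c%:E * (t - k%:E) <= x%:E) = (t <= (k + x / c)%:E))%E.
Proof.
move=> c0; case: t => [t| |].
- by rewrite -EFinB -EFinM !lee_fin -[RHS]lerBlDl ler_pdivlMr // mulrC.
- by rewrite addye // gt0_muley ?lte_fin // !leye_eq.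
- by rewrite addNye gt0_muleNy ?lte_fin // !leNye.
Qed.

Theorem theorem4p8 (R : realType) (d : nat -> measure_display)
    (T : forall m, measurableType (d m)) (P : forall m, probability (T m) R)
    (C : forall m, nat -> {RV (P m) >-> nat})
    (U : forall m, nat -> {RV (P m) >-> R})
    (p : nat -> R) :
  (forall m, (0 < m)%N -> coupon_model m (C m) (U m)) ->
  (forall m, (0 < m)%N -> 0 <= p m < 1) ->
  m%:R * p m @[m --> \oo] --> +oo ->
  cvg_in_law P
    (fun m w => (p m * (1 - p m) ^+ m)%:E *
       (clumsy_time m (p m) (C m) (U m) w - (m%:R * ln m%:R)%:E))%E
    (exponential_law (@ltr01 R)).
Proof.
move=> model p01 mp_oo.
have mX m : measurable_fun [set: T m] (fun w => (p m * (1 - p m) ^+ m)%:E *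
    (clumsy_time m (p m) (C m) (U m) w - (m%:R * ln m%:R)%:E))%E.
  apply: emeasurable_funM; first exact: measurable_cst.
  apply: emeasurable_funB; last exact: measurable_cst.
  exact: measurable_clumsy_time.
split=> // x _.
(* [p m] may vanish for small [m]; once [m p >= 1] the scaling factor is positive. *)
have rate_gt0 : \forall m \near \oo, [/\ (0 < m)%N & 0 < p m * (1 - p m) ^+ m].
  have mp1 := (cvgryPge _).1 mp_oo 1.
  near=> m; have m_gt0 : (0 < m)%N by near: m; exact: nbhs_infty_gt.
  have /andP[p0 p1] := p01 m m_gt0.
  have l1 : 1 <= m%:R * p m by near: m; exact: mp1.
  split => //; rewrite mulr_gt0 ?exprn_gt0 ?subr_gt0 // lt0r p0 andbT.
  by apply/eqP => pm; move: l1; rewrite pm mulr0 ler10.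
pose y (z : R) m : R := m%:R * ln m%:R + z / (p m * (1 - p m) ^+ m).
have probE z : \forall m \near \oo,
    P m [set w | ((p m * (1 - p m) ^+ m)%:E *
       (clumsy_time m (p m) (C m) (U m) w - (m%:R * ln m%:R)%:E) <= z%:E)%E] =
    if 0 <= y z m then (hit (p m) (Num.truncn (y z m)) (finset.set0 : {set 'I_m}))%:E
    else 0%E.
  near=> m; have [m_gt0 r0] : [/\ (0 < m)%N & 0 < p m * (1 - p m) ^+ m].
    by near: m; exact: rate_gt0.
  rewrite -(clumsy_time_le m_gt0 (p01 m m_gt0) (model m m_gt0)); congr (P m _).
  by apply/seteqP; split=> w /=; rewrite scaled_shift_le.
have y_ge0 z : 0 <= z -> \forall m \near \oo, 0 <= y z m.
  move=> z0; near=> m; have [m_gt0 r0] : [/\ (0 < m)%N & 0 < p m * (1 - p m) ^+ m].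
    by near: m; exact: rate_gt0.
  apply: addr_ge0; last by rewrite divr_ge0 // ltW.
  by rewrite mulr_ge0 ?ln_ge0 ?ler1n.
have cdf z : 0 <= z -> P m [set w | ((p m * (1 - p m) ^+ m)%:E *
       (clumsy_time m (p m) (C m) (U m) w - (m%:R * ln m%:R)%:E) <= z%:E)%E]
    @[m --> \oo] --> (1 - expR (- z))%:E.
  move=> z0; apply: (@cvg_trans _
    ((hit (p m) (Num.truncn (y z m)) (finset.set0 : {set 'I_m}))%:E @[m --> \oo])).
    apply: near_eq_cvg; apply: filterS2 (probE z) (y_ge0 z z0) => m /= pE y0.
    by rewrite pE y0.
  apply: cvg_EFin; first by near=> m.
  exact: hit_cvg.
rewrite exponential_law_itvNyc; case: ifPn => x0; first exact: cdf.
(* For negative [x] the distribution function is squeezed below its value at 0, which tends to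
   [1 - exp 0 = 0]. *)
have le0 : x <= 0 by rewrite ltW // ltNge.
apply: (squeeze_cvge _ (cvg_cst 0%E)); last first.
  by have := cdf 0 (lexx 0); rewrite oppr0 expR0 subrr; exact.
near=> m; rewrite measure_ge0 /=; apply: le_measure; rewrite ?in_setE.
- by rewrite -[X in measurable X]setTI; exact: emeasurable_fun_infty_c.
- by rewrite -[X in measurable X]setTI; exact: emeasurable_fun_infty_c.
- by move=> w /= /le_trans; apply; rewrite lee_fin.
Unshelve. all: by end_near. Qed.
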